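(* Let $\mu$ be an infinite cardinal. Suppose that $\vec C$ is a $\square^*_\mu$-sequence such that $V(\vec C)$ contains a club in $\mu^+$, and $\omega\in\Theta_1^\mu(\vec C\restriction A(\vec C),\mu^+)$. Then $T(\rho_0^{\vec C})\nrightarrow[\mu^+]^{n,1}_{\mu^+}$ holds for every positive integer $n$.
   Context: Let $\kappa=\mu^+$. A $C$-sequence over $S\subseteq\kappa$ is $\langle C_\delta\mid\delta\in S\rangle$, each $C_\delta$ closed in $\delta$ with $\sup(C_\delta)=\sup(\delta)$. A $\square^*_\mu$-sequence is a $C$-sequence over $\mu^+$ that is $\mu$-bounded ($\mathrm{otp}(C_\delta)\le\mu$) and weakly coherent (for all $\epsilon<\mu^+$, $|\{C_\delta\cap\epsilon\mid\delta<\mu^+\}|\le\mu$). $\mathrm{acc}(\kappa)$: nonzero limit ordinals below $\kappa$; $\mathrm{acc}(A)=\{\alpha\in A\mid\sup(A\cap\alpha)=\alpha>0\}$, $\mathrm{nacc}(A)=A\setminus\mathrm{acc}(A)$. $V(\vec C)=\{\delta\in\mathrm{acc}(\kappa)\mid\forall\alpha\in(\delta,\kappa)\,\forall\epsilon<\delta\,[C_\delta\cap[\epsilon,\delta)\ne C_\alpha\cap[\epsilon,\delta)]\}$; $A(\vec C)=\{\delta\in\mathrm{acc}(\kappa)\mid\forall\alpha\in(\delta,\kappa)\,[\delta\notin\mathrm{acc}(C_\alpha)]\}$, $\vec C\restriction A(\vec C)=\langle C_\delta\mid\delta\in A(\vec C)\rangle$. For $S,T\subseteq\kappa$, a $C$-sequence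 $\langle C_\delta\mid\delta\in S\rangle$ and a cardinal $\mu$, $\Theta_1^\mu(\vec C,T)$ is the set of nonzero cardinals $\theta$ for which there are $g:\kappa\to\mu$, $h:\kappa\to\theta$ such that for every club $D\subseteq\kappa$ and every $\nu<\mu$ there is $\delta\in S$ with, for every $\tau<\theta$, $\sup\{\gamma\in\mathrm{nacc}(C_\delta)\cap D\cap T\mid g(\mathrm{otp}(C_\delta\cap\gamma))=\nu,\ h(\mathrm{otp}(C_\delta\cap\gamma))=\tau\}=\delta$. Walks: $\mathrm{Tr}(\beta,\gamma)(0)=\gamma$, $\mathrm{Tr}(\beta,\gamma)(n)=\min(C_{\mathrm{Tr}(\beta,\gamma)(n-1)}\setminus\beta)$ if $\mathrm{Tr}(\beta,\gamma)(n-1)>\beta$, else $\beta$; $\rho_2(\beta,\gamma)$ least $l$ with $\mathrm{Tr}(\beta,\gamma)(l)=\beta$; $\rho_0(\beta,\gamma)=\langle\mathrm{otp}(C_{\mathrm{Tr}(\beta,\gamma)(n)}\cap\beta)\mid n<\rho_2(\beta,\gamma)\rangle$. $T(\rho_0^{\vec C})=\{\rho_{0\delta}\restriction\gamma\mid\gamma\le\delta<\kappa\}$ with $\rho_{0\delta}(\xi)=\rho_0(\xi,\delta)$, ordered by $\subseteq$, height of $t$ = $\mathrm{dom}(t)$. Lexicographic order: if $f,g$ comparable, $f<_{\mathrm{lex}}g$ iff $f\supsetneq g$; else compare at the least point of difference, with ordinals compared naturally and elements of ${}^{<\omega}\kappa$ compared by $<_{\mathrm{lex}}$. $\Delta(x,y)$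 = least common-domain point where $x,y$ differ, or $\min\{\mathrm{dom}(x),\mathrm{dom}(y)\}$; $x\wedge y=x\restriction\Delta(x,y)$. A set of $n$-sequences of nodes is rapid if for distinct members, all heights in one lie below all heights in the other. $T\nrightarrow[\kappa]^{n,m}_\theta$: there is $c:T\to\theta$ with (1) for every rapid $S\subseteq{}^nT$ of size $\kappa$ and $\tau<\theta$ there are $(x_k)_{k<n}\ne(y_k)_{k<n}$ in $S$ with $c(x_k\wedge y_k)=\tau$ for all $k$, ($x_k<_{\mathrm{lex}}y_k\Rightarrow\mathrm{dom}(x_k)<\mathrm{dom}(y_k)$) for all $k$, and $|\{\mathrm{dom}(x_k\wedge y_k)\mid k<n\}|\le m$; (2) for every $T'\subseteq T$ of size $\kappa$ there is a rapid $S'\subseteq{}^nT'$ of size $\kappa$ such that for every $S\subseteq S'$ of size $\kappa$ and $\tau\in{}^n\theta$ there are $(x_k)\ne(y_k)$ in $S$ with $c(x_k\wedge y_k)=\tau(k)$ for all $k$ plus the last two conditions of (1). *)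

(* Defs.v *)
(* Ordinals below kappa = mu^+ are modelled by an abstract
   well-ordered type [K M] whose order type is exactly mu^+ (see SuccCard). *)
From Stdlib Require Import Classical ClassicalEpsilon List Arith.
From Stdlib Require Fin.
Set Implicit Arguments.

Definition inj_into {X Y : Type} (A : X -> Prop) (B : Y -> Prop) : Prop :=
  exists f : X -> Y, (forall x, A x -> B (f x)) /\
    (forall x y, A x -> A y -> f x = f y -> x = y).

Definition below {X : Type} (lt : X -> X -> Prop) (a : X) : X -> Prop :=
  fun x => lt x a.

(* An infinite cardinal mu together with kappa = mu^+, realised as the
   well-ordered type K (elements = ordinals < mu^+), with muK the ordinal mu. *)
Record SuccCard : Type := {
  K : Type;
  ltK : K -> K -> Prop;
  muK : K;
  ltK_irrefl : forall x, ~ ltK x x;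
  ltK_trans : forall x y z, ltK x y -> ltK y z -> ltK x z;
  ltK_total : forall x y, ltK x y \/ x = y \/ ltK y x;
  ltK_wf : well_founded ltK;
  mu_infinite : inj_into (fun _ : nat => True) (below ltK muK);
  mu_cardinal : forall a, ltK a muK -> ~ inj_into (below ltK muK) (below ltK a);
  kappa_small : forall a, inj_into (below ltK a) (below ltK muK);
  kappa_big : ~ inj_into (fun _ : K => True) (below ltK muK)
}.

Definition lt {M : SuccCard} (x y : K M) : Prop := ltK M x y.
Definition le {M : SuccCard} (x y : K M) : Prop := lt x y \/ x = y.

Definition is_sup {M : SuccCard} (A : K M -> Prop) (s : K M) : Prop :=
  (forall x, A x -> le x s) /\ (forall t, (forall x, A x -> le x t) -> le s t).

Definition same_sup {M : SuccCard} (A B : K M -> Prop) : Prop :=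
  exists s, is_sup A s /\ is_sup B s.

Definition acc_pt {M : SuccCard} (A : K M -> Prop) (a : K M) : Prop :=
  (exists y, lt y a) /\ is_sup (fun x => A x /\ lt x a) a.

Definition acc_set {M : SuccCard} (A : K M -> Prop) (a : K M) : Prop :=
  A a /\ acc_pt A a.
Definition nacc {M : SuccCard} (A : K M -> Prop) (a : K M) : Prop :=
  A a /\ ~ acc_set A a.

Definition accK {M : SuccCard} (d : K M) : Prop := acc_set (fun _ => True) d.

Definition closed_in {M : SuccCard} (C : K M -> Prop) (d : K M) : Prop :=
  (forall x, C x -> lt x d) /\ (forall a, lt a d -> acc_pt C a -> C a).

Definition C_seq_over {M : SuccCard} (Sd : K M -> Prop) (C : K M -> K M -> Prop) :=
  forall d, Sd d -> closed_in (C d) d /\ same_sup (C d) (below lt d).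

Definition otp_is {M : SuccCard} (A : K M -> Prop) (o : K M) : Prop :=
  exists f : K M -> K M,
    (forall x, A x -> lt (f x) o) /\
    (forall x y, A x -> A y -> lt x y -> lt (f x) (f y)) /\
    (forall z, lt z o -> exists x, A x /\ f x = z).

Definition mu_bounded {M : SuccCard} (C : K M -> K M -> Prop) : Prop :=
  forall d, exists o, otp_is (C d) o /\ le o (muK M).

Definition weakly_coherent {M : SuccCard} (C : K M -> K M -> Prop) : Prop :=
  forall e : K M,
    inj_into (fun X : K M -> Prop => exists d, X = (fun x => C d x /\ lt x e))
             (below lt (muK M)).

Definition square_star {M : SuccCard} (C : K M -> K M -> Prop) : Prop :=
  C_seq_over (fun _ => True) C /\ mu_bounded C /\ weakly_coherent C.

Definition Vset {M : SuccCard} (C : K M -> K M -> Prop) (d : K M) : Prop :=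
  accK d /\ forall a e, lt d a -> lt e d ->
    ~ (forall x, (C d x /\ le e x /\ lt x d) <-> (C a x /\ le e x /\ lt x d)).

Definition Aset {M : SuccCard} (C : K M -> K M -> Prop) (d : K M) : Prop :=
  accK d /\ forall a, lt d a -> ~ acc_set (C a) d.

Definition club {M : SuccCard} (D : K M -> Prop) : Prop :=
  (forall x, exists y, le x y /\ D y) /\ (forall a, acc_pt D a -> D a).

(* θ ∈ Θ_1^μ(⟨C_δ | δ ∈ Sd⟩, T), where the cardinal θ is given as (the
   cardinality of) the type Th; θ = ω corresponds to Th = nat. *)
Definition in_Theta1 {M : SuccCard} (Th : Type) (Sd : K M -> Prop)
    (C : K M -> K M -> Prop) (T : K M -> Prop) : Prop :=
  exists (g : K M -> K M) (h : K M -> Th),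
    (forall x, lt (g x) (muK M)) /\
    forall D, club D -> forall nu, lt nu (muK M) ->
      exists d, Sd d /\ forall tau : Th,
        is_sup (fun c => nacc (C d) c /\ D c /\ T c /\
                   exists o, otp_is (fun x => C d x /\ lt x c) o /\
                             g o = nu /\ h o = tau) d.

Definition least {M : SuccCard} (X : K M -> Prop) : K M :=
  epsilon (inhabits (muK M)) (fun x => X x /\ forall y, X y -> le x y).

Fixpoint Tr {M : SuccCard} (C : K M -> K M -> Prop) (b c : K M) (n : nat) : K M :=
  match n with
  | O => c
  | Datatypes.S n' =>
      let t := Tr C b c n' in
      if excluded_middle_informative (lt b t)
      then least (fun x => C t x /\ le b x) else b
  end.

Definition rho2 {M : SuccCard} (C : K M -> K M -> Prop) (b c : K M) : nat :=
  epsilon (inhabits 0)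
    (fun l => Tr C b c l = b /\ forall l', Tr C b c l' = b -> l <= l').

Definition otp {M : SuccCard} (A : K M -> Prop) : K M :=
  epsilon (inhabits (muK M)) (otp_is A).

Definition rho0 {M : SuccCard} (C : K M -> K M -> Prop) (b c : K M) : list (K M) :=
  map (fun n => otp (fun x => C (Tr C b c n) x /\ lt x b)) (seq 0 (rho2 C b c)).

(* a node is (dom, values); values are [nil] outside dom *)
Definition Node (M : SuccCard) : Type := (K M * (K M -> list (K M)))%type.

Definition restrict {M : SuccCard} (f : K M -> list (K M)) (g : K M) : K M -> list (K M) :=
  fun x => if excluded_middle_informative (lt x g) then f x else nil.

Definition Tnodes {M : SuccCard} (C : K M -> K M -> Prop) (t : Node M) : Prop :=
  exists g d, le g d /\ t = (g, restrict (fun x => rho0 C x d) g).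

Definition sub_node {M : SuccCard} (x y : Node M) : Prop :=
  le (fst x) (fst y) /\ forall z, lt z (fst x) -> snd x z = snd y z.

Fixpoint list_lex {M : SuccCard} (l1 l2 : list (K M)) : Prop :=
  match l1, l2 with
  | nil, _ => False
  | _ :: _, nil => True
  | a :: l1', b :: l2' => lt a b \/ (a = b /\ list_lex l1' l2')
  end.

Definition node_lex {M : SuccCard} (x y : Node M) : Prop :=
  (sub_node y x /\ lt (fst y) (fst x)) \/
  (exists z, lt z (fst x) /\ lt z (fst y) /\ snd x z <> snd y z /\
     (forall w, lt w z -> snd x w = snd y w) /\ list_lex (snd x z) (snd y z)).

Definition Delta {M : SuccCard} (x y : Node M) : K M :=
  least (fun z => (lt z (fst x) /\ lt z (fst y) /\ snd x z <> snd y z) \/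
                  z = fst x \/ z = fst y).

Definition meet {M : SuccCard} (x y : Node M) : Node M :=
  (Delta x y, restrict (snd x) (Delta x y)).

Definition rapid {M : SuccCard} {n : nat} (Sq : (Fin.t n -> Node M) -> Prop) : Prop :=
  forall x y, Sq x -> Sq y -> ~ (forall k, x k = y k) ->
    (forall k l, lt (fst (x k)) (fst (y l))) \/
    (forall k l, lt (fst (y k)) (fst (x l))).

Definition size_kappa (M : SuccCard) {X : Type} (A : X -> Prop) : Prop :=
  inj_into (fun _ : K M => True) A /\ inj_into A (fun _ : K M => True).

Definition good_pair {M : SuccCard} {n : nat} {Th : Type} (m : nat)
    (c : Node M -> Th) (x y : Fin.t n -> Node M) (tau : Fin.t n -> Th) : Prop :=
  (forall k, c (meet (x k) (y k)) = tau k) /\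
  (forall k, node_lex (x k) (y k) -> lt (fst (x k)) (fst (y k))) /\
  (exists l : list (K M), length l <= m /\
     forall k, In (fst (meet (x k) (y k))) l).

(* T ↛ [κ]^{n,m}_θ  with κ = μ^+ (= K M) and θ given as the type Th *)
Definition neg_arrow {M : SuccCard} (T : Node M -> Prop) (n m : nat) (Th : Type) : Prop :=
  exists c : Node M -> Th,
    (forall Sq : (Fin.t n -> Node M) -> Prop,
       (forall x, Sq x -> forall k, T (x k)) -> rapid Sq -> size_kappa M Sq ->
       forall tau : Th, exists x y, Sq x /\ Sq y /\ ~ (forall k, x k = y k) /\
         good_pair m c x y (fun _ => tau)) /\
    (forall T' : Node M -> Prop, (forall t, T' t -> T t) -> size_kappa M T' ->
       exists S' : (Fin.t n -> Node M) -> Prop,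
         (forall x, S' x -> forall k, T' (x k)) /\ rapid S' /\ size_kappa M S' /\
         forall Sq : (Fin.t n -> Node M) -> Prop,
           (forall x, Sq x -> S' x) -> size_kappa M Sq ->
           forall tau : Fin.t n -> Th, exists x y, Sq x /\ Sq y /\
             ~ (forall k, x k = y k) /\ good_pair m c x y tau).

(* Main.v *)
Require Import Defs.
From Stdlib Require Import Classical ClassicalEpsilon List Arith Lia.
From Stdlib Require Import FunctionalExtensionality PropExtensionality.
From mathcomp Require all_boot all_fingroup.

(* Guessing works at the points of [Aset C]: if [d] is such a point, every walk from above [d] to a point just
   below [d] passes through [d], so near [d] a node of the tree takes values [w ++ rho0 x d] with [w] fixed; and if
   [c] is a non-accumulation point of [C d], then [rho0 x d] is [o] followed by [rho0 x c] for [x] close to [c],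
   where [o] is the order type of [C d] below [c].  So guessing lets us insert letters [o] with prescribed values
   of [g] and [h] simultaneously into the words of many nodes.

   The base colour of a node is computed from the longest prefix [w] that its values eventually share: a function
   [sel] of the [h]-values of [w] names a slot, and the colour is the [g]-value of the first letter in that slot.
   Given tuples [x] from a large set and a target [nu], a first letter puts [nu] into a fresh slot [j0] of all
   coordinates.  A second letter [j] is inserted just below a splitting point of two members [d], [d'] of a positive
   set, which makes all coordinates of two tuples split at one common height.  The remaining suffix is the same for
   all coordinates but unknown when [j] is chosen; therefore we split not one but [q] pairs of tuples at once, whose
   words have increasing lengths, and choose [sel] and [j] such that for every suffix one of the [q] pairs has all
   its words sent to [j0] (a word acts on finitely many slots by permutations, the [q] pairs run through all possible
   permutations, and one of them undoes the action of the suffix).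

   Only the [mu] many colours below [mu] are obtained in this way.  Such a colour is finally decoded into an arbitrary
   one, relative to a level of the node which the colour itself singles out by finitely many bits. *)

Set Implicit Arguments.
Unset Strict Implicit.

(** * Small sets and clubs *)

Section Order.
Context {M : SuccCard}.
Implicit Types a b c d x y z : K M.

Lemma olt_irrefl x : lt x x -> False.
Proof. exact (@ltK_irrefl M x). Qed.

Lemma olt_trans x y z : lt x y -> lt y z -> lt x z.
Proof. exact (@ltK_trans M x y z). Qed.

Lemma olt_total x y : lt x y \/ x = y \/ lt y x.
Proof. exact (@ltK_total M x y). Qed.

Lemma olt_wf : well_founded (@lt M).
Proof. exact (@ltK_wf M). Qed.

Lemma ole_refl x : le x x.
Proof. now right. Qed.

Lemma olt_le x y : lt x y -> le x y.
Proof. now left. Qed.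

Lemma olt_ole_trans x y z : lt x y -> le y z -> lt x z.
Proof. intros H [H' | <-]; [now apply olt_trans with y | assumption]. Qed.

Lemma ole_olt_trans x y z : le x y -> lt y z -> lt x z.
Proof. intros [H | ->] H'; [now apply olt_trans with y | assumption]. Qed.

Lemma ole_trans x y z : le x y -> le y z -> le x z.
Proof. intros [H | ->] H'; [left; now apply olt_ole_trans with y | assumption]. Qed.

Lemma olt_or_ole x y : lt x y \/ le y x.
Proof. destruct (olt_total x y) as [H | [-> | H]]; [now left | right; now right | right; now left]. Qed.

Lemma not_olt x y : ~ lt x y -> le y x.
Proof. destruct (olt_or_ole x y); tauto. Qed.

Lemma not_ole x y : ~ le x y -> lt y x.
Proof. destruct (olt_or_ole y x); tauto. Qed.

Lemma ole_antisym x y : le x y -> le y x -> x = y.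
Proof.
  intros [H | H] [H' | H']; auto.
  destruct (olt_irrefl (olt_trans H H')).
Qed.

Lemma olt_not_ole x y : lt x y -> le y x -> False.
Proof. intros H H'. exact (olt_irrefl (olt_ole_trans H H')). Qed.

End Order.

Ltac ord_new P tac := lazymatch goal with _ : P |- _ => fail | _ => assert P by tac end.

Ltac ord_saturate := repeat match goal with
  | H : ~ lt _ _ |- _ => apply not_olt in H
  | H : ~ le _ _ |- _ => apply not_ole in H
  | H : lt ?x ?y, H' : lt ?y ?z |- _ => ord_new (lt x z) ltac:(exact (olt_trans H H'))
  | H : lt ?x ?y, H' : le ?y ?z |- _ => ord_new (lt x z) ltac:(exact (olt_ole_trans H H'))
  | H : le ?x ?y, H' : lt ?y ?z |- _ => ord_new (lt x z) ltac:(exact (ole_olt_trans H H'))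
  | H : le ?x ?y, H' : le ?y ?z |- _ =>
      tryif constr_eq x z then fail else ord_new (le x z) ltac:(exact (ole_trans H H'))
  end.

Ltac ord_close := match goal with
  | H : lt ?x ?x |- _ => destruct (olt_irrefl H)
  | H : lt ?x ?y, H' : le ?y ?x |- _ => destruct (olt_not_ole H H')
  | H : lt ?x ?y, H' : lt ?y ?x |- _ => destruct (olt_irrefl (olt_trans H H'))
  end.

(* Negates the goal and closes the hypotheses under transitivity. *)
Ltac ord := intros;
  match goal with
  | |- lt ?x ?y => let H := fresh in destruct (olt_or_ole x y) as [H | H]; [exact H | exfalso]
  | |- le ?x ?y => let H := fresh in destruct (olt_or_ole y x) as [H | H]; [exfalso | exact H]
  | |- ~ _ => intro
  | |- ?x = ?y => let H := fresh in destruct (olt_total x y) as [H | [H | H]]; [exfalso | exact H | exfalso]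
  | |- False => idtac
  end; try ord_close; ord_saturate; ord_close.

(** * Least elements, injections, and squares of infinite ordinals *)

Section Small.
Context {M : SuccCard}.
Implicit Types a b : K M.

Lemma least_exists (P : K M -> Prop) : (exists x, P x) -> exists x, P x /\ forall y, P y -> le x y.
Proof.
  intros [x Hx]. revert Hx. induction x as [x IH] using (well_founded_induction olt_wf). intros Hx.
  destruct (classic (exists y, P y /\ lt y x)) as [[y [Hy Hyx]] | Hn]; [now apply (IH y)|].
  exists x. split; [assumption|]. intros y Hy. apply not_olt. intros H. apply Hn. now exists y.
Qed.

Lemma least_spec (P : K M -> Prop) : (exists x, P x) -> P (least P) /\ forall y, P y -> le (least P) y.
Proof. intros H. exact (epsilon_spec (inhabits (muK M)) _ (least_exists H)). Qed.

Lemma least_eq (P : K M -> Prop) (x : K M) : P x -> (forall y, P y -> le x y) -> least P = x.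
Proof.
  intros Hx Hm. destruct (least_spec (ex_intro _ x Hx)) as [H1 H2].
  apply ole_antisym; auto.
Qed.

Lemma max2 (x y : K M) : exists z, le x z /\ le y z /\ (z = x \/ z = y).
Proof.
  destruct (olt_or_ole x y) as [H | H].
  - exists y. auto using ole_refl, olt_le.
  - exists x. auto using ole_refl.
Qed.

Lemma max2_lt (x y c : K M) : lt x c -> lt y c -> exists z, le x z /\ le y z /\ lt z c.
Proof. intros. destruct (max2 x y) as [z [? [? [-> | ->]]]]; eauto. Qed.

Lemma inj_into_trans X Y Z (A : X -> Prop) (B : Y -> Prop) (D : Z -> Prop) :
  inj_into A B -> inj_into B D -> inj_into A D.
Proof.
  intros [f [Hf If]] [g [Hg Ig]]. exists (fun x => g (f x)). split; [auto|].
  intros x y Hx Hy E. apply If; auto.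
Qed.

Lemma inj_into_sub X (A B : X -> Prop) : (forall x, A x -> B x) -> inj_into A B.
Proof. intros H. exists (fun x => x). auto. Qed.

Lemma inj_into_pairs X Y X' Y' (A : X -> Prop) (B : Y -> Prop) (A' : X' -> Prop) (B' : Y' -> Prop) :
  inj_into A A' -> inj_into B B' ->
  inj_into (fun p => A (fst p) /\ B (snd p)) (fun p => A' (fst p) /\ B' (snd p)).
Proof.
  intros [f [Hf If]] [g [Hg Ig]]. exists (fun p => (f (fst p), g (snd p))). split.
  - intros [x y] [Hx Hy]. simpl in *. auto.
  - intros [x y] [x' y'] [Hx Hy] [Hx' Hy'] E. simpl in *. injection E as E1 E2.
    f_equal; auto.
Qed.

(** Recursion along [R] sends each [x] to an ordinal below [a] not taken by its predecessors. If
    none were left, choosing preimages would inject [a] into those predecessors. *)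
Lemma embed_wf X (A : X -> Prop) (R : X -> X -> Prop) (a : K M) :
  well_founded R -> (forall x y, A x -> A y -> R x y \/ x = y \/ R y x) ->
  (forall x, A x -> ~ inj_into (below lt a) (fun y => A y /\ R y x)) -> inj_into A (below lt a).
Proof.
  intros Rwf Htot Hn.
  pose (F := fun x (rec : forall y, R y x -> K M) => epsilon (inhabits a)
    (fun b => lt b a /\ forall y (r : R y x), A y -> rec y r <> b)).
  pose (f := Fix Rwf (fun _ => K M) F).
  assert (Ef : forall x, f x = epsilon (inhabits a) (fun b => lt b a /\ forall y, R y x -> A y -> f y <> b)).
  { intros x. unfold f at 1. rewrite Fix_eq.
    - reflexivity.
    - intros z u v E. replace v with u; [reflexivity|].
      apply functional_extensionality_dep. intro y. apply functional_extensionality_dep. intro r. apply E. }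
  assert (Hf : forall x, A x -> lt (f x) a /\ forall y, R y x -> A y -> f y <> f x).
  { intros x Hx. rewrite (Ef x). apply epsilon_spec. apply NNPP. intros Hno.
    apply (Hn x Hx).
    assert (Hy : forall b, lt b a -> exists y, (A y /\ R y x) /\ f y = b).
    { intros b Hb. apply NNPP. intros Hy. apply Hno. exists b. split; [assumption|].
      intros y r Hay E. apply Hy. eauto. }
    exists (fun b => epsilon (inhabits x) (fun y => (A y /\ R y x) /\ f y = b)). split.
    - intros b Hb. apply (epsilon_spec (inhabits x) _ (Hy b Hb)).
    - intros b b' Hb Hb' E.
      rewrite <- (proj2 (epsilon_spec (inhabits x) _ (Hy b Hb))), E.
      apply (proj2 (epsilon_spec (inhabits x) _ (Hy b' Hb'))). }
  exists f. split; [intros x Hx; apply (Hf x Hx)|].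
  intros x y Hx Hy E. destruct (Htot x y Hx Hy) as [H | [H | H]]; [|assumption|].
  - destruct (proj2 (Hf y Hy) x H Hx E).
  - symmetry in E. destruct (proj2 (Hf x Hx) y H Hy E).
Qed.

Definition omax (p : K M * K M) : K M :=
  if excluded_middle_informative (lt (fst p) (snd p)) then snd p else fst p.

(** Goedel's canonical well-order of pairs: all predecessors of a pair have both coordinates bounded
    by its maximum. *)
Definition godel_lt (p q : K M * K M) : Prop :=
  lt (omax p) (omax q) \/
  (omax p = omax q /\ (lt (fst p) (fst q) \/ (fst p = fst q /\ lt (snd p) (snd q)))).

Lemma godel_wf : well_founded godel_lt.
Proof.
  assert (H : forall m a b, omax (a, b) = m -> Acc godel_lt (a, b)).
  { intros m. induction m as [m IHm] using (well_founded_induction olt_wf).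
    intros a. induction a as [a IHa] using (well_founded_induction olt_wf).
    intros b. induction b as [b IHb] using (well_founded_induction olt_wf).
    intros E. constructor. intros [a' b'] [H | [H [H' | [H' H'']]]]; simpl in *.
    - rewrite E in H. now apply (IHm _ H).
    - apply (IHa _ H'). congruence.
    - subst a'. apply (IHb _ H''). congruence. }
  intros [a b]. now apply (H (omax (a, b))).
Qed.

Lemma omax_ge p : le (fst p) (omax p) /\ le (snd p) (omax p).
Proof. unfold omax. destruct excluded_middle_informative; split; ord || apply ole_refl. Qed.

Lemma omax_lt p a : lt (fst p) a -> lt (snd p) a -> lt (omax p) a.
Proof. unfold omax. destruct excluded_middle_informative; auto. Qed.

Definition infinite a := inj_into (fun _ : nat => True) (below lt a).

(** Picking again and again an element off the list of the earlier picks gives an injective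
    sequence. *)
Lemma unlisted_infinite X (A : X -> Prop) :
  (forall l : list X, exists x, A x /\ ~ In x l) -> inj_into (fun _ : nat => True) A.
Proof.
  intros H. destruct (H nil) as [x0 _].
  pose (pick := fun l => epsilon (inhabits x0) (fun x => A x /\ ~ In x l)).
  assert (Hp : forall l, A (pick l) /\ ~ In (pick l) l) by (intros l; apply epsilon_spec, H).
  pose (L := fix L n := match n with 0 => nil | S n => pick (L n) :: L n end).
  assert (HL : forall n m, n < m -> In (pick (L n)) (L m)).
  { intros n m Hnm. induction Hnm; simpl; auto. }
  exists (fun n => pick (L n)). split; [intros n _; apply Hp|].
  intros n m _ _ E. destruct (Nat.lt_trichotomy n m) as [Hl | [Hl | Hl]]; [|assumption|].
  - apply HL in Hl. rewrite E in Hl. now apply Hp in Hl.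
  - apply HL in Hl. rewrite <- E in Hl. now apply Hp in Hl.
Qed.

Lemma nat_not_listed X (l : list X) : ~ inj_into (fun _ : nat => True) (fun x => In x l).
Proof.
  intros [f [Hf If]].
  assert (Hd : NoDup (map f (seq 0 (S (length l))))).
  { apply NoDup_map_NoDup_ForallPairs; [|apply seq_NoDup]. intros x y _ _ E. now apply If. }
  apply NoDup_incl_length with (l' := l) in Hd.
  - rewrite length_map, length_seq in Hd. lia.
  - intros x Hx. apply in_map_iff in Hx. destruct Hx as [n [<- _]]. now apply Hf.
Qed.

(** Hilbert's hotel: [a] moves to [e 0], each [e n] to [e (S n)], and everything else stays. *)
Lemma infinite_shift a : infinite a -> inj_into (fun x => le x a) (below lt a).
Proof.
  intros [e [He Ie]].
  pose (s := fun x => if excluded_middle_informative (x = a) then e 0 else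
    if excluded_middle_informative (exists n, x = e n)
    then e (S (epsilon (inhabits 0) (fun n => x = e n))) else x).
  assert (Hs : forall x, le x a -> (x = a /\ s x = e 0) \/ (exists n, x = e n /\ s x = e (S n)) \/
     (x <> a /\ (~ exists n, x = e n) /\ s x = x)).
  { intros x Hx. unfold s. destruct excluded_middle_informative as [H | H]; [now left|].
    destruct excluded_middle_informative as [H' | H'].
    - right; left. pose proof (epsilon_spec (inhabits 0) _ H') as H2. simpl in H2. eauto.
    - right; right. auto. }
  exists s. split.
  - intros x Hx. destruct (Hs x Hx) as [[_ ->] | [[n [_ ->]] | [H1 [_ ->]]]]; try now apply He.
    destruct Hx; [assumption | contradiction].
  - intros x y Hx Hy E.
    destruct (Hs x Hx) as [[H1 E1] | [[n [H1 E1]] | [H1 [H2 E1]]]];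
    destruct (Hs y Hy) as [[H1' E1'] | [[n' [H1' E1']] | [H1' [H2' E1']]]];
    rewrite E1, E1' in E; try congruence.
    + now apply Ie in E.
    + destruct H2'. now exists 0.
    + apply Ie in E; auto. discriminate.
    + apply Ie in E; auto. congruence.
    + destruct H2'. now exists (S n).
    + destruct H2. now exists 0.
    + destruct H2. now exists (S n').
Qed.

(** Induction on [a]. If [a] injects into a smaller [b], the claim for [b] carries over. Otherwise
    [a] is a cardinal, and an initial segment of the Goedel order lies in the square of the
    successor of some [m] below [a], so it cannot receive [a]. *)
Lemma pairs_below a : infinite a ->
  inj_into (fun p => below lt a (fst p) /\ below lt a (snd p)) (below lt a).
Proof.
  induction a as [a IH] using (well_founded_induction olt_wf). intros Ha.
  destruct (classic (exists b, lt b a /\ inj_into (below lt a) (below lt b))) as [[b [Hb Hi]] | Hcard].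
  - apply inj_into_trans with (B := fun p => below lt b (fst p) /\ below lt b (snd p)).
    + now apply inj_into_pairs.
    + apply inj_into_trans with (B := below lt b).
      * apply IH; [assumption|]. now apply inj_into_trans with (B := below lt a).
      * apply inj_into_sub. intros x Hx. now apply olt_trans with b.
  - apply embed_wf with (R := godel_lt).
    + apply godel_wf.
    + intros [x y] [x' y'] _ _. unfold godel_lt. simpl.
      destruct (olt_total (omax (x, y)) (omax (x', y'))) as [H | [H | H]]; [now left; left| |now right; right; left].
      destruct (olt_total x x') as [H1 | [H1 | H1]]; [left; auto| |right; right; right; auto].
      destruct (olt_total y y') as [H2 | [H2 | H2]]; [left; auto| |right; right; right; auto].
      right; left; congruence.
    + intros x [Hx1 Hx2] Hi. set (m := omax x) in *.
      assert (Hm : lt m a) by (now apply omax_lt).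
      assert (Hi2 : inj_into (below lt a) (fun p : K M * K M => le (fst p) m /\ le (snd p) m)).
      { apply (inj_into_trans Hi). apply inj_into_sub. intros [u v] [_ Huv].
        assert (Hle : le (omax (u, v)) m).
        { destruct Huv as [H | [H _]]; [now left | now right]. }
        destruct (omax_ge (u, v)) as [H1 H2]. simpl in *. split; eapply ole_trans; eassumption. }
      destruct (classic (infinite m)) as [Hinf | Hfin].
      * apply Hcard. exists m. split; [assumption|].
        apply (inj_into_trans Hi2).
        apply inj_into_trans with (B := fun p => below lt m (fst p) /\ below lt m (snd p)).
        -- now apply inj_into_pairs with (A := fun x => le x m) (B := fun x => le x m); apply infinite_shift.
        -- now apply IH.
      (* For finite [m] the square is listed, and the infinite [a] does not inject into a list. *)
      * assert (Hl : exists l : list (K M), forall y, lt y m -> In y l).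
        { apply NNPP. intros Hno. apply Hfin. apply unlisted_infinite. intros l.
          apply NNPP. intros Hno2. apply Hno. exists l. intros y Hy. apply NNPP. intros Hyl.
          apply Hno2. now exists y. }
        destruct Hl as [l Hl].
        apply (@nat_not_listed _ (list_prod (m :: l) (m :: l))).
        apply (inj_into_trans Ha). apply (inj_into_trans Hi2). apply inj_into_sub.
        assert (Hml : forall y, le y m -> In y (m :: l)).
        { intros y [Hy | ->]; [right; auto | now left]. }
        intros [u v] [Hu Hv]. apply in_prod; apply Hml; assumption.
Qed.

End Small.

(** * Sets of cardinality at most mu, and the regularity of kappa *)

Definition small (M : SuccCard) {X : Type} (A : X -> Prop) : Prop := inj_into A (below lt (muK M)).
Definition unbounded {M : SuccCard} (B : K M -> Prop) : Prop := forall b, exists x, B x /\ lt b x.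

Section Small2.
Context {M : SuccCard}.
Implicit Types a b : K M.

Lemma small_sub X (A B : X -> Prop) : (forall x, A x -> B x) -> small M B -> small M A.
Proof. intros H. apply inj_into_trans. now apply inj_into_sub. Qed.

(** The codes in [A] act through a relation that is single-valued on [B], so neither a decoding
    function nor a canonical code has to be named. *)
Lemma small_coded X Y (R : X -> Y -> Prop) (A : X -> Prop) (B : Y -> Prop) :
  (forall y, B y -> exists x, A x /\ R x y) ->
  (forall x y y', B y -> B y' -> R x y -> R x y' -> y = y') -> small M A -> small M B.
Proof.
  intros H Hu [i [Hi Ii]].
  pose (P := fun y c => exists x, A x /\ R x y /\ c = i x).
  assert (HP : forall y, B y -> P y (epsilon (inhabits (muK M)) (P y))).
  { intros y Hy. apply epsilon_spec. destruct (H y Hy) as [x [Hx E]]. exists (i x). now exists x. }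
  exists (fun y => epsilon (inhabits (muK M)) (P y)). split.
  - intros y Hy. destruct (HP y Hy) as [x [Hx [_ E]]]. rewrite E. now apply Hi.
  - intros y y' Hy Hy' E. destruct (HP y Hy) as [x [Hx [E1 E2]]].
    destruct (HP y' Hy') as [x' [Hx' [E1' E2']]].
    rewrite E, E2' in E2. apply Ii in E2; auto. subst x'. now apply (Hu x).
Qed.

Lemma small_image X Y (f : X -> Y) (A : X -> Prop) (B : Y -> Prop) :
  (forall y, B y -> exists x, A x /\ f x = y) -> small M A -> small M B.
Proof.
  intros H. apply small_coded with (R := fun x y => f x = y); [assumption|].
  intros; congruence.
Qed.

Lemma small_prod X Y (A : X -> Prop) (B : Y -> Prop) :
  small M A -> small M B -> small M (fun p => A (fst p) /\ B (snd p)).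
Proof.
  intros HA HB. apply (inj_into_trans (inj_into_pairs HA HB)).
  apply pairs_below, mu_infinite.
Qed.

Lemma small_nat : small M (fun _ : nat => True).
Proof. exact (mu_infinite M). Qed.

(** mu times mu is mu: an element is coded by an index [i] together with its value under a chosen
    injection of [B i] into mu. *)
Lemma small_union X Y (I : X -> Prop) (B : X -> Y -> Prop) :
  small M I -> (forall i, I i -> small M (B i)) -> small M (fun y => exists i, I i /\ B i y).
Proof.
  intros HI HB.
  pose (Q := fun i (j : Y -> K M) => (forall y, B i y -> below lt (muK M) (j y)) /\
     forall y y', B i y -> B i y' -> j y = j y' -> y = y').
  pose (J := fun i => epsilon (inhabits (fun _ : Y => muK M)) (Q i)).
  assert (HJ : forall i, I i -> Q i (J i)).
  { intros i Hi. apply epsilon_spec. exact (HB i Hi). }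
  apply small_sub with (B := fun y => exists p : X * K M, (I (fst p) /\ below lt (muK M) (snd p)) /\
     B (fst p) y /\ J (fst p) y = snd p).
  { intros y [i [Hi Hy]]. exists (i, J i y). simpl. repeat split; auto. now apply (HJ i Hi). }
  assert (Hs : small M (fun p : X * K M => I (fst p) /\ below lt (muK M) (snd p))).
  { apply small_prod; [assumption|]. now apply inj_into_sub. }
  destruct Hs as [e [He Ie]].
  pose (P := fun y c => exists p : X * K M, ((I (fst p) /\ below lt (muK M) (snd p)) /\
     B (fst p) y /\ J (fst p) y = snd p) /\ c = e p).
  assert (HP : forall y, (exists c, P y c) -> P y (epsilon (inhabits (muK M)) (P y))).
  { intros y. apply epsilon_spec. }
  assert (HP' : forall y, (exists p : X * K M, (I (fst p) /\ below lt (muK M) (snd p)) /\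
     B (fst p) y /\ J (fst p) y = snd p) -> P y (epsilon (inhabits (muK M)) (P y))).
  { intros y [p Hp]. apply HP. exists (e p). now exists p. }
  exists (fun y => epsilon (inhabits (muK M)) (P y)). split.
  - intros y Hy. destruct (HP' y Hy) as [p [[Hp _] E]]. rewrite E. now apply He.
  - intros y y' Hy Hy' E. destruct (HP' y Hy) as [p [[Hp [Hp1 Hp2]] E1]].
    destruct (HP' y' Hy') as [p' [[Hp' [Hp1' Hp2']] E1']].
    rewrite E, E1' in E1. apply Ie in E1; auto. subst p'.
    destruct Hp as [Hp0 _]. destruct (HJ _ Hp0) as [_ HJi]. apply HJi; congruence.
Qed.

Lemma small_list X (A : X -> Prop) : small M A -> small M (fun l => Forall A l).
Proof.
  intros HA.
  assert (Hn : forall n, small M (fun l => length l = n /\ Forall A l)).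
  { induction n as [|n IHn].
    - apply small_image with (f := fun _ : nat => @nil X) (A := fun _ => True); [|apply small_nat].
      intros l [El _]. exists 0. destruct l; [auto | discriminate].
    - apply small_image with (f := fun p : X * list X => fst p :: snd p)
        (A := fun p => A (fst p) /\ (length (snd p) = n /\ Forall A (snd p))).
      + intros l [El Fl]. destruct l as [|x l]; [discriminate|]. inversion Fl.
        exists (x, l). simpl. auto.
      + now apply small_prod with (B := fun l => length l = n /\ Forall A l). }
  apply small_sub with (B := fun l => exists n, True /\ (length l = n /\ Forall A l)).
  - intros l Hl. eauto.
  - apply small_union; auto using small_nat.
Qed.

Lemma small_single X (x : X) : small M (eq x).
Proof.
  apply small_image with (f := fun _ : nat => x) (A := fun _ => True); [|apply small_nat].
  intros y <-. now exists 0.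
Qed.

Lemma small_below a : small M (below lt a).
Proof. apply kappa_small. Qed.

Lemma small_le a : small M (fun x => le x a).
Proof.
  destruct (small_below a) as [i [Hi Ii]].
  apply inj_into_trans with (B := fun x => le x (muK M)); [|apply infinite_shift, mu_infinite].
  exists (fun x => if excluded_middle_informative (x = a) then muK M else i x).
  assert (H : forall x, le x a -> x <> a -> lt x a) by (intros x [|]; tauto). split.
  - intros x Hx. destruct excluded_middle_informative; [apply ole_refl | left]. apply Hi, H; assumption.
  - intros x y Hx Hy.
    destruct excluded_middle_informative as [E | E]; destruct excluded_middle_informative as [E' | E'].
    + congruence.
    + intros E2. exfalso. apply (@olt_irrefl M (muK M)). rewrite E2 at 1. apply Hi, H; assumption.
    + intros E2. exfalso. apply (@olt_irrefl M (muK M)). rewrite <- E2 at 1. apply Hi, H; assumption.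
    + apply Ii; apply H; assumption.
Qed.

(** Otherwise kappa would be a union of at most mu initial segments, each of size at most mu. *)
Lemma small_bounded (A : K M -> Prop) : small M A -> exists b, forall x, A x -> lt x b.
Proof.
  intros HA. apply NNPP. intros Hno. apply (kappa_big M).
  apply small_sub with (B := fun y => exists x, A x /\ le y x).
  - intros y _. apply NNPP. intros Hy. apply Hno. exists y. intros x Hx. apply not_ole.
    intros H. apply Hy. eauto.
  - apply small_union; [assumption|]. intros. apply small_le.
Qed.

Lemma succ_exists a : exists b, lt a b.
Proof.
  destruct (small_bounded (small_single a)) as [b Hb]. eauto.
Qed.

Lemma bound2 a b : exists d, lt a d /\ lt b d.
Proof.
  destruct (max2 a b) as [c [H1 [H2 _]]]. destruct (succ_exists c) as [d Hd].
  exists d. split; ord.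
Qed.

Lemma small_family_bounded X (I : X -> Prop) (f : X -> K M) :
  small M I -> exists b, forall i, I i -> lt (f i) b.
Proof.
  intros HI. destruct (@small_bounded (fun y => exists i, I i /\ f i = y)) as [b Hb].
  - now apply small_image with (f := f) (A := I).
  - exists b. intros i Hi. apply Hb. eauto.
Qed.

Lemma not_unbounded (B : K M -> Prop) : ~ unbounded B -> exists b, forall x, B x -> le x b.
Proof.
  intros H. apply not_all_ex_not in H. destruct H as [b Hb]. exists b. intros x Hx.
  apply not_olt. intros Hl. apply Hb. eauto.
Qed.

(** If every class were bounded, the at most mu many bounds would have a common bound, and [B] would
    be bounded. *)
Lemma unbounded_pigeonhole X (I : X -> Prop) (B : K M -> Prop) (P : X -> K M -> Prop) :
  small M I -> unbounded B -> (forall x, B x -> exists i, I i /\ P i x) ->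
  exists i, I i /\ unbounded (fun x => B x /\ P i x).
Proof.
  intros HI HB HP. apply NNPP. intros Hno.
  assert (Hb : forall i, I i -> exists b, forall x, B x /\ P i x -> le x b).
  { intros i Hi. apply not_unbounded. intros H. apply Hno. eauto. }
  destruct (small_family_bounded
    (fun i => epsilon (inhabits (muK M)) (fun b => forall x, B x /\ P i x -> le x b)) HI) as [b Hbb].
  destruct (HB b) as [x [Hx Hbx]]. destruct (HP x Hx) as [i [Hi Hix]].
  pose proof (epsilon_spec (inhabits (muK M)) _ (Hb i Hi) x (conj Hx Hix)) as H1.
  pose proof (Hbb i Hi) as H2. cbv beta in H1, H2. ord.
Qed.

(** At stage [a] there are at most mu earlier choices, so some [b] exceeds [d] of all of them; [f a]
    is then chosen to satisfy [G b]. *)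
Lemma transfinite_choice X (d : X -> K M) (G : K M -> X -> Prop) :
  (forall b, exists x, G b x) ->
  exists f : K M -> X, forall a, exists b, (forall a', lt a' a -> lt (d (f a')) b) /\ G b (f a).
Proof.
  intros HG. destruct (HG (muK M)) as [x0 _].
  pose (bd := fun a (rec : forall a', lt a' a -> X) =>
    epsilon (inhabits a) (fun b => forall a' (r : lt a' a), lt (d (rec a' r)) b)).
  pose (F := fun a (rec : forall a', lt a' a -> X) => epsilon (inhabits x0) (G (bd a rec))).
  pose (f := Fix olt_wf (fun _ => X) F).
  assert (Ef : forall a, f a = F a (fun a' _ => f a')).
  { intros a. unfold f at 1. rewrite Fix_eq; [reflexivity|].
    intros z u v E. replace v with u; [reflexivity|].
    apply functional_extensionality_dep. intro y. apply functional_extensionality_dep. intro r. apply E. }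
  exists f. intros a. exists (bd a (fun a' _ => f a')). split.
  - unfold bd. apply epsilon_spec. destruct (small_family_bounded (fun a' => d (f a')) (small_below a)) as [b Hb].
    exists b. intros a' r. now apply Hb.
  - rewrite (Ef a). unfold F. apply epsilon_spec, HG.
Qed.

Lemma unbounded_of_inj (B : K M -> Prop) : inj_into (fun _ : K M => True) B -> unbounded B.
Proof.
  intros H. apply NNPP. intros Hn. destruct (not_unbounded Hn) as [b Hb].
  apply (kappa_big M). apply (inj_into_trans H). revert Hb. intros Hb. apply small_sub with (B := fun x => le x b); [assumption | apply small_le].
Qed.

End Small2.

(** * Closed unbounded sets and diagonal intersections *)

Section Clubs.
Context {M : SuccCard}.
Implicit Types a b : K M.

Lemma is_sup_approx (A : K M -> Prop) a x : is_sup A a -> lt x a -> exists y, A y /\ lt x y.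
Proof.
  intros [_ H] Hx. apply NNPP. intros Hno.
  assert (le a x); [|ord]. apply H. intros y Hy. apply not_olt. intros H'. apply Hno. eauto.
Qed.

Lemma acc_pt_approx (A : K M -> Prop) a x : acc_pt A a -> lt x a -> exists y, A y /\ lt x y /\ lt y a.
Proof. intros [_ H] Hx. destruct (is_sup_approx H Hx) as [y [[H1 H2] H3]]. eauto. Qed.

Lemma acc_pt_intro (A : K M -> Prop) a :
  (exists y, lt y a) -> (forall x, lt x a -> exists y, A y /\ lt x y /\ lt y a) -> acc_pt A a.
Proof.
  intros He H. split; [assumption|]. split; [intros x [_ Hx]; now left|].
  intros t Ht. apply not_olt. intros Hta. destruct (H t Hta) as [y [Hy [Hty Hya]]].
  assert (le y t) by (apply Ht; auto). ord.
Qed.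

Lemma acc_pt_mono (A B : K M -> Prop) a : (forall x, A x -> B x) -> acc_pt A a -> acc_pt B a.
Proof.
  intros H Ha. apply acc_pt_intro; [apply Ha|]. intros x Hx.
  destruct (acc_pt_approx Ha Hx) as [y [H1 H2]]. eauto.
Qed.

Lemma not_acc_pt (A : K M -> Prop) a :
  (exists y, lt y a) -> ~ acc_pt A a -> exists e, lt e a /\ forall x, A x -> lt x a -> le x e.
Proof.
  intros He H. apply NNPP. intros Hno. apply H. apply acc_pt_intro; [assumption|].
  intros x Hx. apply NNPP. intros Hy. apply Hno. exists x. split; [assumption|].
  intros y H1 H2. apply not_olt. intros H3. apply Hy. eauto.
Qed.

(** A bound for [G] on initial segments is iterated omega times from [x]; the supremum of the
    iterates is a closure point. *)
Lemma club_closure (G : K M -> K M) : club (fun d => forall x, lt x d -> lt (G x) d).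
Proof.
  split.
  - intros x.
    assert (Hb : forall u, exists v, lt u v /\ forall y, le y u -> lt (G y) v).
    { intros u. destruct (small_family_bounded G (small_le u)) as [v Hv].
      destruct (bound2 u v) as [w [H1 H2]]. exists w. split; [assumption|].
      intros y Hy. apply Hv in Hy. ord. }
    pose (nx := fun u => epsilon (inhabits u) (fun v => lt u v /\ forall y, le y u -> lt (G y) v)).
    assert (Hnx : forall u, lt u (nx u) /\ forall y, le y u -> lt (G y) (nx u)).
    { intros u. unfold nx. apply epsilon_spec, Hb. }
    pose (s := fix s n := match n with 0 => x | S n => nx (s n) end).
    destruct (small_family_bounded s small_nat) as [b Hbd].
    destruct (@least_exists M (fun d => forall n, lt (s n) d)) as [d [Hd Hm]].
    { exists b. intros n. now apply Hbd. }
    exists d. split; [left; exact (Hd 0)|]. intros y Hy.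
    assert (Hn : exists n, le y (s n)).
    { apply NNPP. intros Hno. assert (le d y); [|ord]. apply Hm. intros n. apply not_ole.
      intros H. apply Hno. eauto. }
    destruct Hn as [n Hn]. apply olt_trans with (s (S n)); [|apply Hd]. now apply Hnx.
  - intros a Ha x Hx. destruct (acc_pt_approx Ha Hx) as [y [H1 [H2 H3]]].
    apply olt_trans with y; auto.
Qed.

Lemma club_above (D : K M -> Prop) b : club D -> club (fun x => D x /\ lt b x).
Proof.
  intros [H1 H2]. split.
  - intros x. destruct (bound2 x b) as [z [Hx Hb]]. destruct (H1 z) as [y [Hy HD]].
    exists y. split; [|split]; [ord | assumption | ord].
  - intros a Ha. split.
    + apply H2. revert Ha. apply acc_pt_mono. tauto.
    + destruct Ha as [[y Hy] Ha]. assert (Ha' : acc_pt (fun x => D x /\ lt b x) a) by (split; eauto).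
      destruct (acc_pt_approx Ha' Hy) as [z [[_ Hz] [_ Hza]]]. ord.
Qed.

(** The diagonal intersection. A closure point of a function that bounds next elements of the [D v]
    is a limit of every [D v] with [v] below it. *)
Lemma club_diag (D : K M -> K M -> Prop) :
  (forall v, club (D v)) -> club (fun c => forall v, lt v c -> D v c).
Proof.
  intros HD.
  assert (Hn : forall v x, exists y, D v y /\ lt x y).
  { intros v x. destruct (proj1 (club_above x (HD v)) x) as [y [_ Hy]]. eauto. }
  pose (nx := fun v x => epsilon (inhabits x) (fun y => D v y /\ lt x y)).
  assert (Hnx : forall v x, D v (nx v x) /\ lt x (nx v x)).
  { intros v x. unfold nx. apply epsilon_spec, Hn. }
  assert (Hb : forall u, exists b, forall p : K M * K M, le (fst p) u /\ le (snd p) u -> lt (nx (fst p) (snd p)) b).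
  { intros u. apply small_family_bounded with (f := fun p : K M * K M => nx (fst p) (snd p)).
    apply small_prod with (A := fun x => le x u) (B := fun x => le x u); apply small_le. }
  pose (G := fun u => epsilon (inhabits u) (fun b => forall p : K M * K M, le (fst p) u /\ le (snd p) u -> lt (nx (fst p) (snd p)) b)).
  assert (HG : forall u v x, le v u -> le x u -> lt (nx v x) (G u)).
  { intros u v x Hv Hx. apply (epsilon_spec (inhabits u) _ (Hb u) (v, x)). auto. }
  split.
  - intros x. destruct (proj1 (club_closure G) x) as [c [Hxc Hc]].
    exists c. split; [assumption|]. intros v Hv. apply (proj2 (HD v)).
    apply acc_pt_intro; [eauto|]. intros y Hy.
    destruct (max2_lt Hv Hy) as [u [Hvu [Hyu Huc]]].
    exists (nx v y). pose proof (Hnx v y) as [H1 H2]. pose proof (HG u v y Hvu Hyu). pose proof (Hc u Huc).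
    repeat split; [assumption | assumption | ord].
  - intros a Ha v Hv. apply (proj2 (HD v)). apply acc_pt_intro; [eauto|].
    intros x Hx. destruct (max2_lt Hv Hx) as [u [Hvu [Hxu Hua]]].
    destruct (acc_pt_approx Ha Hua) as [c [Hc [Huc Hca]]].
    exists c. repeat split; [apply Hc; ord | ord | assumption].
Qed.

End Clubs.

(** * Walks *)

Definition pos {M : SuccCard} (b : K M) : Prop := exists y, lt y b.

(** * Uniqueness of order types *)

Section OrderType.
Context {M : SuccCard}.
Implicit Types (A : K M -> Prop) (o : K M).

(** By induction [f'] is bounded by [f] wherever its values lie below [o']. A point sent to [o] by
    [f'] would be sent below [o] by [f], a contradiction. *)
Lemma otp_is_le A o o' (f f' : K M -> K M) :
  (forall x y, A x -> A y -> lt x y -> lt (f x) (f y)) -> (forall x, A x -> lt (f x) o) ->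
  (forall x y, A x -> A y -> lt x y -> lt (f' x) (f' y)) ->
  (forall z, lt z o' -> exists x, A x /\ f' x = z) -> le o' o.
Proof.
  intros Hf Ho Hf' Hs.
  assert (H : forall x, A x -> lt (f' x) o' -> le (f' x) (f x)).
  { intros x. induction x as [x IH] using (well_founded_induction olt_wf). intros Hx Hxo.
    apply not_olt. intros Hl. destruct (Hs (f x)) as [y [Hy E]]; [ord|].
    destruct (olt_total x y) as [H | [<- | H]].
    - pose proof (Hf' _ _ Hx Hy H). rewrite E in *. ord.
    - rewrite E in Hl. ord.
    - assert (Hle : le (f' y) (f y)) by (apply IH; [assumption | assumption | rewrite E; ord]).
      pose proof (Hf _ _ Hy Hx H). rewrite E in Hle. ord. }
  apply not_olt. intros Hl. destruct (Hs o Hl) as [x [Hx E]].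
  assert (le (f' x) (f x)) by (apply H; [assumption | congruence]).
  pose proof (Ho x Hx). rewrite E in *. ord.
Qed.

Lemma otp_is_unique A o o' : otp_is A o -> otp_is A o' -> o = o'.
Proof.
  intros [f [H1 [H2 H3]]] [f' [H1' [H2' H3']]].
  apply ole_antisym; [exact (otp_is_le H2' H1' H2 H3) | exact (otp_is_le H2 H1 H2' H3')].
Qed.

Lemma otp_eq A o : otp_is A o -> otp A = o.
Proof.
  intros H. apply (@otp_is_unique A); [|assumption].
  unfold otp. apply epsilon_spec. now exists o.
Qed.

End OrderType.

Section Walks.
Context {M : SuccCard} (C : K M -> K M -> Prop).
Hypothesis Hsq : square_star C.
Implicit Types b c d x y z : K M.

(** One step of the walk from [c] to [b]; [seg] is the letter that this step contributes to
    [rho0]. *)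
Definition nxt b c := least (fun x => C c x /\ le b x).
Definition seg c b := otp (fun x => C c x /\ lt x b).

Lemma C_lt c x : C c x -> lt x c.
Proof. destruct Hsq as [H _]. apply (H c I). Qed.

(** If [C c] stayed below [b], the common supremum of [C c] and [c] would be [b], and closedness
    would put [b] into [C c]. For [b] zero and [c] one the set [C c] may be empty; hence the
    assumption [pos] on targets of walks. *)
Lemma C_above b c : pos b -> lt b c -> exists x, C c x /\ le b x.
Proof.
  intros Hb Hbc. destruct Hsq as [H _]. destruct (H c I) as [[H1 H2] [s [[Hs1 Hs2] [Hs3 Hs4]]]].
  apply NNPP. intros Hno.
  assert (Hlt : forall x, C c x -> lt x b).
  { intros x Hx. apply not_ole. intros Hle. apply Hno. eauto. }
  assert (s = b).
  { apply ole_antisym; [|now apply Hs3]. apply Hs2. intros x Hx. left. auto. }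
  subst s. destruct (@olt_irrefl M b). apply Hlt, H2; [assumption|]. split; [assumption|].
  split; [now intros x [Hx _]; apply Hs1|]. intros t Ht. apply Hs2. intros x Hx. auto.
Qed.

Lemma nxt_spec b c : pos b -> lt b c ->
  C c (nxt b c) /\ le b (nxt b c) /\ lt (nxt b c) c /\ forall x, C c x -> le b x -> le (nxt b c) x.
Proof.
  intros Hb Hbc. destruct (least_spec (C_above Hb Hbc)) as [[H1 H2] H3].
  repeat split; auto. now apply C_lt.
Qed.

Lemma nxt_eq b c x : C c x -> le b x -> (forall y, C c y -> le b y -> le x y) -> nxt b c = x.
Proof. intros H1 H2 H3. apply least_eq; [auto | intros y [Hy1 Hy2]; auto]. Qed.

(** The part of [C c] below [b] consists of the predecessors of [nxt b c] in [C c]. Hence one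
    isomorphism of [C c] with an ordinal at most mu gives all letters, and a letter determines the
    step. *)
Lemma seg_iso c : exists f : K M -> K M,
  (forall x y, C c x -> C c y -> lt x y -> lt (f x) (f y)) /\ (forall x, C c x -> lt (f x) (muK M)) /\
  forall b, pos b -> lt b c -> seg c b = f (nxt b c).
Proof.
  destruct Hsq as [_ [H _]]. destruct (H c) as [o [[f [H1 [H2 H3]]] Ho]].
  exists f. split; [assumption|]. split.
  { intros x Hx. specialize (H1 x Hx). ord. }
  intros b Hb Hbc. destruct (nxt_spec Hb Hbc) as [Hn1 [Hn2 [Hn3 Hn4]]].
  apply otp_eq. exists f. split; [|split].
  - intros x [Hx Hxb]. apply H2; auto. ord.
  - intros x y [Hx _] [Hy _]. now apply H2.
  - intros z Hz. destruct (H3 z) as [x [Hx E]]; [specialize (H1 _ Hn1); ord|].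
    exists x. split; [|assumption]. split; [assumption|]. apply not_ole. intros Hbx.
    destruct (Hn4 x Hx Hbx) as [Hl | El]; [|rewrite El, E in Hz; ord].
    specialize (H2 _ _ Hn1 Hx Hl). rewrite E in H2. ord.
Qed.

Lemma seg_lt_mu b c : pos b -> lt b c -> lt (seg c b) (muK M).
Proof.
  intros Hb Hbc. destruct (seg_iso c) as [f [_ [H2 H3]]]. rewrite H3; auto. now apply H2, nxt_spec.
Qed.

Lemma seg_inj b b' c : pos b -> pos b' -> lt b c -> lt b' c -> seg c b = seg c b' -> nxt b c = nxt b' c.
Proof.
  intros Hb Hb' Hbc Hbc'. destruct (seg_iso c) as [f [H1 [H2 H3]]]. rewrite !H3 by assumption.
  destruct (nxt_spec Hb Hbc) as [Hn _]. destruct (nxt_spec Hb' Hbc') as [Hn' _]. intros E.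
  destruct (olt_total (nxt b c) (nxt b' c)) as [H | [H | H]]; [|assumption|];
  apply H1 in H; auto; rewrite E in H; destruct (olt_irrefl H).
Qed.

Lemma Tr_shift b c n : Tr C b c (S n) = Tr C b (Tr C b c 1) n.
Proof.
  induction n as [|n IH]; [reflexivity|].
  change (Tr C b c (S (S n))) with (let t := Tr C b c (S n) in
    if excluded_middle_informative (lt b t) then least (fun x => C t x /\ le b x) else b).
  rewrite IH. reflexivity.
Qed.

Lemma Tr_one b c : lt b c -> Tr C b c 1 = nxt b c.
Proof. intros H. simpl. destruct excluded_middle_informative; [reflexivity | contradiction]. Qed.

Lemma Tr_reaches b c : pos b -> le b c -> exists n, Tr C b c n = b.
Proof.
  intros Hb. induction c as [c IH] using (well_founded_induction olt_wf).
  intros [Hbc | <-]; [|now exists 0]. destruct (nxt_spec Hb Hbc) as [H1 [H2 [H3 _]]].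
  destruct (IH _ H3 H2) as [n Hn]. exists (S n). now rewrite Tr_shift, Tr_one.
Qed.

Lemma rho2_eq b c n : Tr C b c n = b -> (forall m, Tr C b c m = b -> n <= m) -> rho2 C b c = n.
Proof.
  intros H1 H2.
  assert (H : exists l, Tr C b c l = b /\ forall l', Tr C b c l' = b -> l <= l') by eauto.
  apply (epsilon_spec (inhabits 0)) in H. fold (rho2 C b c) in H. destruct H as [H3 H4].
  apply Nat.le_antisymm; auto.
Qed.

Lemma rho2_spec b c : pos b -> le b c -> Tr C b c (rho2 C b c) = b /\ forall m, Tr C b c m = b -> rho2 C b c <= m.
Proof.
  intros Hb Hbc. unfold rho2. apply epsilon_spec.
  destruct (Tr_reaches Hb Hbc) as [n Hn]. revert Hn.
  induction n as [n IH] using (well_founded_induction Nat.lt_wf_0). intros Hn.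
  destruct (classic (exists m, Tr C b c m = b /\ m < n)) as [[m [H1 H2]] | Hno]; [eauto|].
  exists n. split; [assumption|]. intros m Hm. apply Nat.nlt_ge. intros H. eauto.
Qed.

Lemma rho0_refl b : rho0 C b b = nil.
Proof. unfold rho0. rewrite (@rho2_eq b b 0); auto. intros; lia. Qed.

Lemma rho0_cons b c : pos b -> lt b c -> rho0 C b c = seg c b :: rho0 C b (nxt b c).
Proof.
  intros Hb Hbc. destruct (nxt_spec Hb Hbc) as [_ [H2 _]].
  destruct (rho2_spec Hb H2) as [H3 H4].
  assert (E : rho2 C b c = S (rho2 C b (nxt b c))).
  { apply rho2_eq.
    - now rewrite Tr_shift, Tr_one.
    - intros [|m] Hm; [simpl in Hm; subst; destruct (olt_irrefl Hbc)|].
      rewrite Tr_shift, Tr_one in Hm by assumption. apply H4 in Hm. lia. }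
  unfold rho0. rewrite E. cbn [seq map Tr]. f_equal.
  rewrite <- seq_shift, map_map. apply map_ext. intros n. now rewrite Tr_shift, Tr_one.
Qed.

Lemma rho0_letters b c : pos b -> le b c -> Forall (fun o => lt o (muK M)) (rho0 C b c).
Proof.
  intros Hb. induction c as [c IH] using (well_founded_induction olt_wf).
  intros [Hbc | <-]; [|rewrite rho0_refl; constructor]. rewrite rho0_cons by assumption.
  destruct (nxt_spec Hb Hbc) as [_ [H2 [H3 _]]]. constructor; [now apply seg_lt_mu | auto].
Qed.

(** Letters determine steps, so two walks from [c] with the same word take the same steps and end at
    the same point. *)
Lemma rho0_inj b b' c : pos b -> pos b' -> le b c -> le b' c -> rho0 C b c = rho0 C b' c -> b = b'.
Proof.
  intros Hb Hb'. induction c as [c IH] using (well_founded_induction olt_wf).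
  intros [Hbc | <-] [Hbc' | Hbc'].
  - rewrite (rho0_cons Hb Hbc), (rho0_cons Hb' Hbc'). intros E. injection E as E1 E2.
    apply seg_inj in E1; auto. rewrite <- E1 in E2.
    destruct (nxt_spec Hb Hbc) as [_ [H2 [H3 _]]]. destruct (nxt_spec Hb' Hbc') as [_ [H2' [H3' _]]].
    rewrite <- E1 in H2'. eauto.
  - subst b'. rewrite rho0_refl, rho0_cons by assumption. discriminate.
  - rewrite rho0_refl, rho0_cons by assumption. discriminate.
  - auto.
Qed.

(** [C c] misses an interval just below [d], so the first step towards any point of that interval is
    the first step towards [d]. *)
Lemma nxt_stable d c : pos d -> lt d c -> ~ acc_pt (C c) d ->
  exists e, lt e d /\ forall x, lt e x -> lt x d -> nxt x c = nxt d c /\ seg c x = seg c d.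
Proof.
  intros Hd Hdc Hn. destruct (not_acc_pt Hd Hn) as [e [He H]]. exists e. split; [assumption|].
  intros x Hex Hxd. destruct (nxt_spec Hd Hdc) as [H1 [H2 [H3 H4]]].
  assert (E : nxt x c = nxt d c).
  { apply nxt_eq; [assumption | ord|]. intros y Hy Hxy. apply H4; [assumption|].
    apply not_olt. intros Hyd. specialize (H y Hy Hyd). ord. }
  split; [assumption|]. destruct (seg_iso c) as [f [_ [_ Hf]]].
  rewrite !Hf, E; auto; [now exists e | ord].
Qed.

Lemma Aset_not_acc d c : Aset C d -> lt d c -> ~ acc_pt (C c) d.
Proof.
  intros [_ H] Hdc Ha. apply (H c Hdc). split; [|assumption].
  destruct Hsq as [Hs _]. now apply (Hs c I).
Qed.

Lemma Aset_limit d : Aset C d -> pos d /\ forall x, lt x d -> exists y, lt x y /\ lt y d.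
Proof.
  intros [[_ Ha] _]. split; [apply Ha|]. intros x Hx.
  destruct (acc_pt_approx Ha Hx) as [y [_ Hy]]. eauto.
Qed.

(** Induction along the walk from [c] to [d]: no [C]-set met before [d] accumulates at [d], so walks
    to points just below [d] first take the same steps down to [d]. *)
Lemma rho0_concat d c : Aset C d -> le d c ->
  exists e, lt e d /\ forall x, lt e x -> lt x d -> rho0 C x c = rho0 C d c ++ rho0 C x d.
Proof.
  intros Hd. destruct (Aset_limit Hd) as [Hp _].
  induction c as [c IH] using (well_founded_induction olt_wf). intros [Hdc | <-].
  - destruct (nxt_stable Hp Hdc (Aset_not_acc Hd Hdc)) as [e1 [He1 H1]].
    destruct (nxt_spec Hp Hdc) as [_ [H2 [H3 _]]].
    destruct (IH _ H3 H2) as [e2 [He2 H4]]. destruct (max2_lt He1 He2) as [e [Hl1 [Hl2 He]]].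
    exists e. split; [assumption|]. intros x Hex Hxd.
    rewrite (@rho0_cons d), (@rho0_cons x) by (first [assumption | ord | now exists e]).
    destruct (H1 x) as [E1 E2]; [ord | ord|]. rewrite E1, E2, H4 by ord. reflexivity.
  - destruct Hp as [e He]. exists e. split; [assumption|]. intros. now rewrite rho0_refl.
Qed.

(** An isolated point [c] of [C d] is itself the first step towards all points just below it. *)
Lemma rho0_nacc c d : nacc (C d) c -> pos c ->
  exists e, lt e c /\ forall x, lt e x -> lt x c -> rho0 C x d = seg d c :: rho0 C x c.
Proof.
  intros [Hc Hn] Hp. assert (Hcd := C_lt Hc).
  assert (Hna : ~ acc_pt (C d) c) by (intros H; apply Hn; now split).
  destruct (nxt_stable Hp Hcd Hna) as [e [He H]]. exists e. split; [assumption|].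
  intros x Hex Hxc. destruct (H x Hex Hxc) as [E1 E2].
  assert (E : nxt c d = c) by (apply nxt_eq; auto using ole_refl).
  rewrite rho0_cons, E1, E2, E; [reflexivity | now exists e | ord].
Qed.

(** * Levels of the tree have size at most mu, and there is no cofinal branch *)

Lemma zero_unique x y : ~ pos x -> ~ pos y -> x = y.
Proof.
  intros Hx Hy. destruct (olt_total x y) as [H | [H | H]]; [|assumption|].
  - destruct Hy. now exists x.
  - destruct Hx. now exists y.
Qed.

(** A set cut off at zero is empty, so all letters coincide and [rho2], possibly a default value
    here, is the only information. *)
Lemma rho0_zero x c : ~ pos x -> rho0 C x c = repeat (otp (fun _ => False)) (rho2 C x c).
Proof.
  intros Hx. unfold rho0. generalize 0. induction (rho2 C x c) as [|n IH]; intros k; [reflexivity|].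
  simpl. f_equal; [|apply IH]. f_equal. apply functional_extensionality. intros y.
  apply propositional_extensionality. split; [|contradiction]. intros [_ Hy]. apply Hx. now exists y.
Qed.

(* [trace z d l]: the list of the sets [C e] cut off at [z], for [e] along the walk from [d] to [z] *)
Inductive trace z : K M -> list (K M -> Prop) -> Prop :=
| trace_nil : trace z z nil
| trace_cons d l : lt z d -> trace z (nxt z d) l -> trace z d ((fun x => C d x /\ lt x z) :: l).

Lemma trace_exists z d : pos z -> le z d ->
  exists l, Forall (fun X => exists d, X = (fun x => C d x /\ lt x z)) l /\ trace z d l.
Proof.
  intros Hz. induction d as [d IH] using (well_founded_induction olt_wf).
  intros [Hd | <-]; [|exists nil; split; constructor].
  destruct (nxt_spec Hz Hd) as [_ [H2 [H3 _]]]. destruct (IH _ H3 H2) as [l [Hl Ht]].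
  exists ((fun x => C d x /\ lt x z) :: l). split; constructor; eauto.
Qed.

Lemma trace_inv z d X l : trace z d (X :: l) ->
  lt z d /\ X = (fun x => C d x /\ lt x z) /\ trace z (nxt z d) l.
Proof. inversion 1; auto. Qed.

(** As long as the walk to [x] stays at or above [z], it follows the walk to [z]. When it drops
    below [z], it reaches the same point from [d] and from [d'], because the cuts at [z] agree. *)
Lemma trace_determines z d d' l x : pos x -> lt x z -> trace z d l -> trace z d' l ->
  rho0 C x d = rho0 C x d'.
Proof.
  intros Hx Hxz Ht. revert d'. assert (Hz : pos z) by now exists x.
  induction Ht as [|d l Hd Ht IH]; intros d' Ht'; [inversion Ht'; reflexivity|].
  destruct (trace_inv Ht') as [Hd' [E1 Ht'']].
  assert (HC : forall y, lt y z -> C d y <-> C d' y).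
  { intros y Hy. pose proof (f_equal (fun X => X y) E1) as E. cbv beta in E.
    assert (H : (C d y /\ lt y z) <-> (C d' y /\ lt y z)) by (rewrite E; tauto). tauto. }
  assert (Hs : seg d x = seg d' x).
  { unfold seg. f_equal. apply functional_extensionality. intros y. apply propositional_extensionality.
    split; intros [H1 H2]; (split; [apply HC; [ord | assumption] | assumption]). }
  assert (Hxd : lt x d) by ord. assert (Hxd' : lt x d') by ord.
  rewrite (rho0_cons Hx Hxd), (rho0_cons Hx Hxd'). f_equal; [assumption|].
  destruct (nxt_spec Hx Hxd) as [H1 [H2 [H3 H4]]].
  destruct (nxt_spec Hx Hxd') as [H1' [H2' [H3' H4']]].
  destruct (nxt_spec Hz Hd) as [G1 [G2 [G3 G4]]].
  destruct (nxt_spec Hz Hd') as [G1' [G2' [G3' G4']]].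
  destruct (olt_or_ole (nxt x d) z) as [Hn | Hn].
  - replace (nxt x d') with (nxt x d); [reflexivity|].
    assert (Hle : le (nxt x d') (nxt x d)) by (apply H4'; [apply HC|]; assumption).
    apply ole_antisym; [|assumption]. apply H4; [|assumption]. apply HC; [ord | assumption].
  - assert (Hn' : le z (nxt x d')).
    { apply not_olt. intros Hl. assert (le (nxt x d) (nxt x d')) by (apply H4; [apply HC|]; assumption). ord. }
    replace (nxt x d) with (nxt z d).
    + replace (nxt x d') with (nxt z d'); [now apply IH|].
      apply ole_antisym; [auto|]. apply H4'; [assumption | ord].
    + apply ole_antisym; [auto|]. apply H4; [assumption | ord].
Qed.

(** Weak coherence leaves at most mu many cuts at [z], hence at most mu many traces, and a trace
    fixes all values at nonzero points. The additional number is [rho2] at zero. *)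
Lemma level_small z : small M (fun f => exists d, le z d /\ f = restrict (fun x => rho0 C x d) z).
Proof.
  destruct (classic (pos z)) as [Hz | Hz].
  - assert (Hs : small M (fun p : list (K M -> Prop) * nat =>
      Forall (fun X => exists d, X = (fun x => C d x /\ lt x z)) (fst p) /\ True)).
    { apply small_prod with (A := Forall _) (B := fun _ => True); [|apply small_nat].
      apply small_list. destruct Hsq as [_ [_ H]]. apply H. }
    revert Hs. apply small_coded with (R := fun p f => exists d, le z d /\ f = restrict (fun x => rho0 C x d) z /\
      trace z d (fst p) /\ forall x, ~ pos x -> rho2 C x d = snd p).
    + intros f [d [Hd E]]. destruct (trace_exists Hz Hd) as [l [Hl Ht]].
      destruct (@least_exists M (fun _ => True)) as [x0 [_ Hx0]]; [now exists z|].
      assert (Hx0' : ~ pos x0) by (intros [y Hy]; specialize (Hx0 y I); ord).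
      exists (l, rho2 C x0 d). split; [simpl; auto|]. exists d. simpl. repeat split; auto.
      intros x Hx. now rewrite (zero_unique Hx Hx0').
    + intros p f f' _ _ [d [Hd [-> [Ht Hr]]]] [d' [Hd' [-> [Ht' Hr']]]].
      apply functional_extensionality. intros x. unfold restrict.
      destruct excluded_middle_informative as [Hx | _]; [|reflexivity].
      destruct (classic (pos x)) as [Hp | Hp].
      * now apply trace_determines with z (fst p).
      * rewrite !rho0_zero, Hr, Hr' by assumption. reflexivity.
  - apply small_sub with (B := eq (fun _ => nil)); [|apply small_single].
    intros f [d [_ ->]]. apply functional_extensionality. intros x. unfold restrict.
    destruct excluded_middle_informative as [Hx | _]; [|reflexivity]. destruct Hz. now exists x.
Qed.

Lemma words_small : small M (Forall (fun o : K M => lt o (muK M))).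
Proof. apply small_list, small_below. Qed.

(* A cofinal branch would embed the nonzero ordinals into the words over [mu]. *)
Lemma no_cofinal_branch (b : K M -> list (K M)) :
  ~ forall z, exists d, le z d /\ forall x, pos x -> lt x z -> rho0 C x d = b x.
Proof.
  intros Hb.
  assert (Hs : small M (@pos M)).
  { generalize words_small. apply small_coded with (R := fun w x => w = b x).
    - intros x Hx. destruct (succ_exists x) as [z Hz]. destruct (Hb z) as [d [Hd E]].
      exists (b x). split; [|reflexivity]. rewrite <- E by assumption. apply rho0_letters; [assumption | left; ord].
    - intros w x y Hx Hy E1 E2. destruct (bound2 x y) as [z [Hxz Hyz]]. destruct (Hb z) as [d [Hd E]].
      apply rho0_inj with d; auto; [left; ord | left; ord|].
      rewrite !E by assumption. congruence. }
  destruct (small_bounded Hs) as [u Hu]. destruct (succ_exists u) as [c Hc].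
  assert (lt c u) by (apply Hu; now exists u). ord.
Qed.

(** Otherwise the functions given by the members of [B] would fit together to a cofinal branch. *)
Lemma no_branch (B : K M -> Prop) : unbounded B ->
  exists d d' x, B d /\ B d' /\ lt x d /\ lt x d' /\ pos x /\ rho0 C x d <> rho0 C x d'.
Proof.
  intros HB. apply NNPP. intros Hno.
  pose (t := fun x => epsilon (inhabits x) (fun d => B d /\ lt x d)).
  assert (Ht : forall x, B (t x) /\ lt x (t x)) by (intros x; apply epsilon_spec, HB).
  apply (@no_cofinal_branch (fun x => rho0 C x (t x))). intros z.
  destruct (HB z) as [d [Hd Hzd]]. exists d. split; [now left|]. intros x Hx Hxz.
  apply NNPP. intros Hne. apply Hno. exists d, (t x), x. destruct (Ht x). repeat split; auto. ord.
Qed.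

(** * Stable prefixes of the values close to a level *)

Definition eventual z (f : K M -> list (K M)) (p : list (K M)) : Prop :=
  exists e, lt e z /\ forall x, le e x -> lt x z -> exists r, f x = p ++ r.
Definition stable_prefix z f p : Prop := eventual z f p /\ forall a, ~ eventual z f (p ++ a :: nil).

Lemma prefix_comparable (X : Type) (p p' r r' : list X) : p ++ r = p' ++ r' ->
  p = p' \/ (exists a s, p' = p ++ a :: s) \/ (exists a s, p = p' ++ a :: s).
Proof.
  revert p'. induction p as [|a p IH]; intros [|a' p'] E; simpl in *; auto.
  - right; left. now exists a', p'.
  - right; right. now exists a, p.
  - injection E as -> E. destruct (IH _ E) as [-> | [[b [s ->]] | [b [s ->]]]]; auto.
    + right; left. now exists b, s.
    + right; right. now exists b, s.
Qed.

Lemma stable_prefix_unique z f p p' : stable_prefix z f p -> stable_prefix z f p' -> p = p'.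
Proof.
  intros [[e [He H]] Hm] [[e' [He' H']] Hm'].
  destruct (max2_lt He He') as [e1 [H1 [H2 H3]]].
  destruct (H e1 H1 H3) as [r E]. destruct (H' e1 H2 H3) as [r' E']. rewrite E in E'.
  destruct (prefix_comparable E') as [-> | [[a [s ->]] | [a [s ->]]]]; [reflexivity| |].
  - destruct (Hm a). exists e'. split; [assumption|]. intros x Hx Hxz.
    destruct (H' x Hx Hxz) as [r1 Hr]. exists (s ++ r1). rewrite Hr, <- !app_assoc. reflexivity.
  - destruct (Hm' a). exists e. split; [assumption|]. intros x Hx Hxz.
    destruct (H x Hx Hxz) as [r1 Hr]. exists (s ++ r1). rewrite Hr, <- !app_assoc. reflexivity.
Qed.

Lemma eventual_app z f g u p e : lt e z -> (forall x, le e x -> lt x z -> f x = u ++ g x) ->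
  eventual z f (u ++ p) <-> eventual z g p.
Proof.
  intros He H. split; intros [e' [He' H']]; destruct (max2_lt He He') as [e1 [H1 [H2 H3]]];
  exists e1; (split; [assumption|]); intros x Hx Hxz; destruct (H' x) as [r E]; try ord; exists r.
  - rewrite H in E by ord. rewrite <- app_assoc in E. now apply app_inv_head in E.
  - rewrite H by ord. now rewrite E, app_assoc.
Qed.

Lemma stable_prefix_app z f g u p e : lt e z -> (forall x, le e x -> lt x z -> f x = u ++ g x) ->
  stable_prefix z g p -> stable_prefix z f (u ++ p).
Proof.
  intros He H [H1 H2]. split.
  - now apply (eventual_app p He H).
  - intros a Ha. apply (H2 a). rewrite <- app_assoc in Ha. now apply (eventual_app _ He H).
Qed.

(** At a successor [z] the prefix is the value at the predecessor. At a limit, follow the walk from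
    [c] towards [z]: as long as the current [C]-set does not accumulate at [z], the next letter is
    constant near [z]. Accumulation occurs at [z] itself at the latest, and there the prefix
    ends. *)
Lemma stable_prefix_exists z c : pos z -> le z c -> exists p, stable_prefix z (fun x => rho0 C x c) p.
Proof.
  intros Hz. destruct (classic (exists e, lt e z /\ forall x, lt x z -> le x e)) as [[e [He Hm]] | Hlim].
  { intros _. exists (rho0 C e c). split.
    - exists e. split; [assumption|]. intros x Hx Hxz. exists nil.
      rewrite app_nil_r. f_equal. apply ole_antisym; auto.
    - intros a [e' [He' H]]. destruct (H e (Hm e' He') He) as [r E].
      rewrite <- app_assoc in E. rewrite <- app_nil_r in E at 1. apply app_inv_head in E. discriminate. }
  assert (Hl : forall x, lt x z -> exists y, lt x y /\ lt y z).
  { intros x Hx. apply NNPP. intros Hno. apply Hlim. exists x. split; [assumption|].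
    intros y Hy. apply not_olt. intros Hxy. apply Hno. eauto. }
  (* Distinct points [x] and [y] of [C d] close to [z] have different first letters, so no first
     letter is shared. *)
  assert (Hnil : forall c, le z c -> acc_pt (C c) z -> stable_prefix z (fun x => rho0 C x c) nil).
  { intros d Hd Ha. split.
    - destruct Hz as [e He]. exists e. split; [assumption|]. intros x _ _. now exists (rho0 C x d).
    - intros a [e [He H]]. simpl in H. destruct (acc_pt_approx Ha He) as [x [Hx [Hex Hxz]]].
      destruct (acc_pt_approx Ha Hxz) as [y [Hy [Hxy Hyz]]].
      assert (Hpx : pos x) by (exists e; ord). assert (Hpy : pos y) by (exists e; ord).
      destruct (H x) as [r E]; [ord | ord|]. destruct (H y) as [r' E']; [ord | ord|].
      rewrite rho0_cons in E, E' by (assumption || ord).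
      cbn [app] in E, E'. assert (En : nxt x d = nxt y d) by (apply seg_inj; [assumption | assumption | ord | ord | congruence]).
      assert (nxt x d = x) by (apply nxt_eq; auto using ole_refl).
      assert (nxt y d = y) by (apply nxt_eq; auto using ole_refl).
      assert (x = y) by congruence. subst y. ord. }
  induction c as [c IH] using (well_founded_induction olt_wf). intros Hc.
  destruct (classic (acc_pt (C c) z)) as [Ha | Hna]; [exists nil; auto|].
  destruct Hc as [Hc | <-].
  - destruct (nxt_stable Hz Hc Hna) as [e [He H]]. destruct (nxt_spec Hz Hc) as [_ [H2 [H3 _]]].
    destruct (IH _ H3 H2) as [p Hp]. destruct (Hl e He) as [e' [He' Hez]].
    exists (seg c z :: p). apply (@stable_prefix_app z _ (fun x => rho0 C x (nxt z c)) (seg c z :: nil) p e'); [assumption| |assumption].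
    intros x Hx Hxz. destruct (H x) as [E1 E2]; [ord | ord|].
    rewrite rho0_cons, E1, E2; [reflexivity | exists e; ord | ord].
  - destruct Hna. apply acc_pt_intro; [assumption|]. intros x Hx. destruct (Hl x Hx) as [y [Hxy Hyz]].
    assert (Hy : pos y) by now exists x.
    destruct (C_above Hy Hyz) as [u [Hu Hyu]]. exists u. repeat split; [assumption | ord | now apply C_lt].
Qed.

End Walks.

(** * Selecting a slot from a word *)

Set Warnings "-notation-overridden".
Module WordMachine.
Import all_boot all_fingroup.
Local Open Scope group_scope.

(** Induction on the size of [B :\: A]: a transposition exchanges a point of [B] outside [A] with a
    point of [A] outside [B], which exists because [B] is not larger than [A]. *)
Lemma perm_into (T : finType) (A B : {set T}) :
  #|B| <= #|A| -> exists r : {perm T}, forall x, x \in B -> r x \in A.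
Proof.
  have [k] := ubnP #|B :\: A|; elim: k B => // k IH B Hk HBA.
  have [/eqP BA0 | [x xBA]] := set_0Vmem (B :\: A).
    by exists 1 => x xB; rewrite perm1; move: BA0; rewrite setD_eq0 => /subsetP; apply.
  have [y yAB] : exists y, y \in A :\: B.
    apply/set0Pn; rewrite -card_gt0 cardsD subn_gt0 setIC.
    apply: leq_trans _ HBA; rewrite -(cardsID A B) -addn1 leq_add2l card_gt0.
    by apply/set0Pn; exists x.
  move: xBA yAB; rewrite !inE => /andP[xA xB] /andP[yB yA].
  have [||r Hr] := IH (tperm x y @: B).
  - rewrite ltnS in Hk; apply: leq_trans _ Hk; apply: proper_card; apply/properP; split.
      apply/subsetP => z; rewrite !inE => /andP[zA /imsetP[u uB ezu]].
      move: zA; rewrite ezu; case: tpermP => [_ | euy | xu yu]; first by rewrite yA.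
        by rewrite euy (negPf yB) in uB.
      by rewrite uB => ->.
    exists x; rewrite !inE xA //=; apply/negP => /imsetP[u uB].
    case: tpermP => [eu exy | euy _ | xu yu exu] //; last by rewrite exu in xu.
      by rewrite exy yA in xA.
    by rewrite euy (negPf yB) in uB.
  - by rewrite card_imset //; apply: perm_inj.
  exists (tperm x y * r) => z zB; rewrite permM; apply: Hr; exact: imset_f.
Qed.

Lemma injective_nat_above (f : nat -> nat) (b : nat) : injective f -> exists N, b < f N.
Proof.
  move=> injf; case: (boolP [exists i : 'I_b.+2, b < f i]) => [/existsP[i Hi] | /existsPn H].
    by exists i.
  pose g (i : 'I_b.+2) : 'I_b.+1 := inord (f i).
  have Hg i : val (g i) = f i by rewrite /= inordK // ltnS leqNgt H.
  have/leq_card : injective g.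
    by move=> i j /(congr1 val); rewrite !Hg => /injf; apply: val_inj.
  by rewrite !card_ord ltnn.
Qed.

(** * A machine that reads words and acts on finitely many positions by permutations *)

Section Machine.
Variable n : nat.

(** For each number [m] the machine keeps a position in [slotT]. Of the 2n+2 positions half are
    active, so any n of them can be permuted into the active half, or into the inactive half. *)
Definition top_slot := (n + n.+1)%N.
Local Notation slotT := 'I_top_slot.+1.
Definition active (x : slotT) : bool := x <= n.

Lemma card_active : #|[set x | active x]| = n.+1.
Proof.
  rewrite cardsE -sum1_card (@big_split_ord _ _ _ n.+1 n.+1) /= [X in (_ + X)%N]big1 ?addn0; last first.
    by move=> i H; have {H} : n.+1 + i <= n := H; rewrite addSn ltnNge leq_addr.
  by rewrite (eq_bigl xpredT) ?sum1_card ?card_ord // => i; apply: (ltn_ord i).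
Qed.

Lemma perm_active (b : bool) (B : seq slotT) : size B <= n ->
  exists r : {perm slotT}, forall x, x \in B -> active (r x) = b.
Proof.
  move=> HB; have Ec : #|[set x | active x == b]| = n.+1.
    case: b; first by rewrite -[RHS]card_active; apply: eq_card => x; rewrite !inE eqb_id.
    have := cardsC [set x | active x]; rewrite card_active card_ord => /(@addnI n.+1 _ n.+1) E; rewrite -[RHS]E.
    by apply: eq_card => x; rewrite !inE; case: (active x).
  have [|r Hr] := @perm_into slotT [set x | active x == b] [set x in B].
    rewrite Ec cardsE; apply: leq_trans (card_size B) _; exact: leq_trans HB _.
  exists r => x xB; have xB' : x \in [set x in B] by rewrite inE.
  by have := Hr x xB'; rewrite inE => /eqP.
Qed.

(* A command lists, for groups of histories, the permutations to apply to the slots.  A letter is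
   the code of a command (tagged by a number, so that every command has arbitrarily large codes). *)
Definition command : Type := seq (seq (seq nat) * seq {perm slotT}).
Definition decode (a : nat) : command := odflt [::] (omap fst (unpickle a : option (command * nat))).
Definition weight (h : seq nat) : nat := size h + sumn h.

Definition lookup (c : command) (h : seq nat) : option (seq {perm slotT}) :=
  let i := find (fun e => h \in e.1) c in
  if i < size c then Some (nth ([::], [::]) c i).2 else None.

(** A command that lists the current history resets it to the letter [a], after which all listed
    words behave alike. The test that [a] exceeds the weight lets the weight grow with every letter,
    also at a reset. *)
Definition step (s : seq nat * (nat -> slotT)) (a : nat) : seq nat * (nat -> slotT) :=
  if weight s.1 < a then
    if lookup (decode a) s.1 is Some ps then ([:: a], fun m => nth 1 ps m (s.2 m))
    else (rcons s.1 a, s.2)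
  else (rcons s.1 a, s.2).

Definition run (w : seq nat) := foldl step ([::], fun _ => ord0) w.
Definition rank (w : seq nat) : nat := weight (run w).1.
Definition sel (w : seq nat) : nat := epsilon (inhabits 0)
  (fun m => active ((run w).2 m) /\ forall m', m' < m -> ~~ active ((run w).2 m')).

Lemma weight_step s a : weight s.1 < weight (step s a).1.
Proof.
  have Hr : weight s.1 < weight (rcons s.1 a).
    by rewrite /weight size_rcons -cats1 sumn_cat addSn ltnS leq_add2l leq_addr.
  rewrite /step; case: ifP => // Ha; case: (lookup _ _) => //= _.
  by rewrite /weight /= addn0 add1n ltnS ltnW.
Qed.

Lemma size_le_rank w : size w <= rank w.
Proof.
  rewrite /rank /run; set s := (_, _).
  suff : forall s, weight s.1 + size w <= weight (foldl step s w).1.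
    by move/(_ s); apply: leq_trans; rewrite leq_addl.
  elim: w => [|a w IH] {}s /=; first by rewrite addn0.
  by apply: leq_trans (IH _); rewrite addnS -addSn leq_add2r weight_step.
Qed.

(** The history evolves independently of the positions [z], hence so do the permutations applied
    along [p]. *)
Lemma common_evolution (p : seq nat) (h : seq nat) : exists pi : nat -> {perm slotT},
  forall z m, (foldl step (h, z) p).2 m = pi m (z m).
Proof.
  elim: p h => [|a p IH] h /=; first by exists (fun _ => 1) => z m; rewrite perm1.
  have [pi Hpi] := IH (rcons h a).
  case Ha: (weight h < a); last by exists pi => z m; rewrite {2}/step /= Ha Hpi.
  case El: (lookup (decode a) h) => [ps|]; last by exists pi => z m; rewrite {2}/step /= Ha El Hpi.
  have [pi' Hpi'] := IH [:: a]; exists (fun m => nth 1 ps m * pi' m) => z m.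
  by rewrite {2}/step /= Ha El Hpi' permM.
Qed.

Lemma sel_eq w m : active ((run w).2 m) -> (forall m', m' < m -> ~~ active ((run w).2 m')) -> sel w = m.
Proof.
  move=> H1 H2; rewrite /sel; set P := (fun m => _).
  have [H3 H4] : P (epsilon (inhabits 0) P) by apply: epsilon_spec; exists m.
  case: (ltngtP (epsilon (inhabits 0) P) m) => // H.
    by have := H2 _ H; rewrite H3.
  by have := H4 _ H; rewrite H1.
Qed.

(** All possible joint actions on the positions of the numbers up to [j0]; one group of words is
    needed for each. *)
Definition patterns (j0 : nat) : seq (j0.+1.-tuple {perm slotT}) := enum {: j0.+1.-tuple {perm slotT}}.

(** For group [i] the command applies to position [m] a permutation [R i m] making it active exactly
    when [m = j0], followed by the [i]-th pattern. The suffix then acts by fixed permutations, and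
    the group whose pattern consists of their inverses undoes this action. *)
Lemma selection (j0 : nat) (W : nat -> seq (seq nat)) :
  (forall i, i < size (patterns j0) -> size (W i) <= n) ->
  (forall i i', i < i' -> i' < size (patterns j0) ->
     forall w w', w \in W i -> w' \in W i' -> rank w < rank w') ->
  exists j, forall p, exists2 i, i < size (patterns j0) & forall w, w \in W i -> sel (w ++ j :: p) = j0.
Proof.
  set q := size _ => HW Hr.
  pose s i m := nth 1 (nth [tuple of nseq j0.+1 1] (patterns j0) i) m.
  pose ok i m (r : {perm slotT}) := all (fun w => active (r ((run w).2 m)) == (m == j0)) (W i).
  (* For fixed [m] the words of a group occupy at most [n] positions, so [perm_active] supplies
     [R i m]. *)
  have [R HR] : exists R : nat -> nat -> {perm slotT}, forall i m, i < q -> ok i m (R i m).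
    exists (fun i m => odflt 1 [pick r | ok i m r]) => i m Hi; case: pickP => //= Hno.
    have [|r Hr'] := @perm_active (m == j0) [seq (run w).2 m | w <- W i]; first by rewrite size_map HW.
    suff : ok i m r by rewrite Hno.
    by apply/allP => w wW; apply/eqP/Hr'; apply/mapP; exists w.
  pose cmd : command := [seq ([seq (run w).1 | w <- W i], [seq R i m * s i m | m <- iota 0 j0.+1]) | i <- iota 0 q].
  (* A suitable tag [N] makes the code of the command exceed the ranks of all words concerned. *)
  pose b := \max_(i < q) \max_(w <- W i) rank w.
  have [|N HN] := @injective_nat_above (fun N => pickle (cmd, N)) b.
    by move=> x y /(pcan_inj pickleK) [].
  exists (pickle (cmd, N)) => p; set j := pickle _.
  have Hj i w : i < q -> w \in W i ->
      run (rcons w j) = ([:: j], fun m => nth 1 [seq R i m * s i m | m <- iota 0 j0.+1] m ((run w).2 m)).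
    move=> Hi wW; rewrite /run foldl_rcons -/(run w) /step -/(rank w).
    have -> : rank w < j.
      apply: leq_ltn_trans HN; apply: leq_trans (leq_bigmax (Ordinal Hi)) => /=.
      by rewrite big_seq (big_rem w) //= wW leq_maxl.
    have -> : decode j = cmd by rewrite /decode /j pickleK.
    have Enth k : k < q -> nth ([::], [::]) cmd k =
        ([seq (run w).1 | w <- W k], [seq R k m * s k m | m <- iota 0 j0.+1]).
      by move=> Hk; rewrite (nth_map 0) ?size_iota // nth_iota.
    have -> // : lookup cmd (run w).1 = Some [seq R i m * s i m | m <- iota 0 j0.+1].
      rewrite /lookup; set a := (fun e => _).
      have Ec : size cmd = q by rewrite size_map size_iota.
      have Ha : a (nth ([::], [::]) cmd i) by rewrite Enth // /a /= map_f.
      have Hha : has a cmd by apply/(has_nthP ([::], [::])); exists i; rewrite ?Ec.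
      (* Ranks increase strictly from group to group, so no history of group [i] is listed in an
         earlier entry. *)
      have -> : find a cmd = i.
        case: (ltngtP (find a cmd) i) => // H.
          have := nth_find ([::], [::]) Hha; rewrite Enth ?(ltn_trans H) // => /mapP[w' w'W Ew].
          by have := Hr _ _ H Hi _ _ w'W wW; rewrite /rank Ew ltnn.
        by have := before_find ([::], [::]) H; rewrite Ha.
      by rewrite Ec Hi Enth.
  have [pi Hpi] := common_evolution p [:: j].
  pose t : j0.+1.-tuple {perm slotT} := [tuple of mkseq (fun m => (pi m)^-1) j0.+1].
  have tP : t \in patterns j0 by rewrite mem_enum.
  exists (index t (patterns j0)); first by rewrite index_mem.
  set i := index _ _ => w wW.
  have Hi : i < q by rewrite index_mem.
  have Efin m : m <= j0 -> (run (w ++ j :: p)).2 m = R i m ((run w).2 m).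
    move=> Hm; rewrite -cat_rcons /run foldl_cat -/(run _) (Hj i) // Hpi.
    rewrite (nth_map 0) ?size_iota // nth_iota // add0n /s nth_index // /t /=.
    by rewrite nth_mkseq // !permM permKV.
  apply: sel_eq => [|m' Hm'].
    by rewrite Efin //; have /allP/(_ w wW)/eqP -> := HR i j0 Hi; rewrite eqxx.
  by rewrite Efin ?(ltnW Hm') //; have /allP/(_ w wW)/eqP -> := HR i m' Hi; rewrite ltn_eqF.
Qed.

End Machine.

Lemma word_selection (n : nat) : exists (sel : list nat -> nat) (q : nat -> nat) (rank : list nat -> nat),
  (forall w, Peano.le (length w) (rank w)) /\
  forall j0 (W : nat -> list (list nat)),
    (forall i, Peano.lt i (q j0) -> Peano.le (length (W i)) n) ->
    (forall i i', Peano.lt i i' -> Peano.lt i' (q j0) ->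
      forall w w', In w (W i) -> In w' (W i') -> Peano.lt (rank w) (rank w')) ->
    exists j, forall p, exists i, Peano.lt i (q j0) /\
      forall w, In w (W i) -> sel (app w (cons j p)) = j0.
Proof.
  have InE (w : seq nat) (l : seq (seq nat)) : In w l <-> w \in l.
    elim: l => [|v l IH] /=; first by split.
    rewrite in_cons; split => [[-> | /IH ->] | /orP[/eqP -> | /IH]]; rewrite ?eqxx ?orbT; auto.
  exists (sel n), (fun j0 => size (patterns n j0)), (rank n); split.
    by move=> w; apply/leP; apply: size_le_rank.
  move=> j0 W HW Hr; have [| |j Hj] := @selection n j0 W.
  - by move=> i /ltP Hi; apply/leP; apply: HW.
  - by move=> i i' /ltP H1 /ltP H2 w w' /InE H3 /InE H4; apply/ltP; apply: (Hr i i').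
  - exists j => p; have [i Hi H] := Hj p; exists i; split; first by apply/ltP.
    by move=> w /InE; apply: H.
Qed.

End WordMachine.

(** * Guessing *)

Lemma fin_enumeration n : exists l : list (Fin.t n), length l = n /\ forall k, In k l.
Proof.
  induction n as [|n [l [Hl Hin]]].
  - exists nil. split; [reflexivity|]. intros k. inversion k.
  - exists (Fin.F1 :: map Fin.FS l). split; [simpl; now rewrite length_map, Hl|].
    intros k. apply (Fin.caseS' k); [now left|]. intros p. right. now apply in_map.
Qed.

Lemma fin_max n (f : Fin.t n -> nat) : exists N, forall k, f k <= N.
Proof.
  destruct (fin_enumeration n) as [l [_ Hl]]. exists (list_max (map f l)). intros k.
  pose proof (proj1 (list_max_le (map f l) _) (Nat.le_refl _)) as H. rewrite Forall_map, Forall_forall in H.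
  apply H, Hl.
Qed.

Lemma list_bound_below {M : SuccCard} X (l : list X) (d : K M) (P : X -> K M -> Prop) :
  pos d -> (forall x e e', P x e -> le e e' -> lt e' d -> P x e') ->
  (forall x, In x l -> exists e, lt e d /\ P x e) -> exists e, lt e d /\ forall x, In x l -> P x e.
Proof.
  intros Hd Hm. induction l as [|a l IH]; intros H.
  - destruct Hd as [e He]. exists e. split; [assumption|]. intros x [].
  - destruct IH as [e1 [He1 H1]]; [intros x Hx; apply H; now right|].
    destruct (H a) as [e2 [He2 H2]]; [now left|].
    destruct (max2_lt He1 He2) as [e [Hl1 [Hl2 He]]]. exists e. split; [assumption|].
    intros x [<- | Hx]; eauto.
Qed.

Lemma small_tuples {M : SuccCard} n X (A : X -> Prop) : small M A -> small M (fun w : Fin.t n -> X => forall k, A (w k)).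
Proof.
  intros H. destruct (fin_enumeration n) as [l [_ Hl]].
  generalize (small_list H). apply small_coded with (R := fun L w => L = map w l).
  - intros w Hw. exists (map w l). split; [|reflexivity]. apply Forall_map, Forall_forall. auto.
  - intros L w w' _ _ -> E. apply functional_extensionality. intros k.
    now apply (ext_in_map E).
Qed.

Lemma restrict_lt {M : SuccCard} (f : K M -> list (K M)) z x : lt x z -> restrict f z x = f x.
Proof. intros H. unfold restrict. destruct excluded_middle_informative; tauto. Qed.

Lemma restrict_ext {M : SuccCard} (f g : K M -> list (K M)) z :
  (forall x, lt x z -> f x = g x) -> restrict f z = restrict g z.
Proof.
  intros H. apply functional_extensionality. intros x. unfold restrict.
  destruct excluded_middle_informative; auto.
Qed.

Lemma restrict_eq {M : SuccCard} (f g : K M -> list (K M)) z x :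
  restrict f z = restrict g z -> lt x z -> f x = g x.
Proof.
  intros E Hx. rewrite <- (restrict_lt f Hx), <- (restrict_lt g Hx). now rewrite E.
Qed.

(** * Positive sets for guessing on [Aset C] *)

Section Guessing.
Context {M : SuccCard} (C : K M -> K M -> Prop).
Hypothesis Hsq : square_star C.
Variables (g : K M -> K M) (h : K M -> nat).
Hypothesis HTheta : forall D, club D -> forall nu, lt nu (muK M) ->
  exists d, Aset C d /\ forall tau : nat,
    is_sup (fun c => nacc (C d) c /\ D c /\ True /\
               exists o, otp_is (fun x => C d x /\ lt x c) o /\ g o = nu /\ h o = tau) d.
Implicit Types b c d e nu : K M.

Definition guesses (D : K M -> Prop) nu d : Prop := forall j b, lt b d ->
  exists c, lt b c /\ nacc (C d) c /\ D c /\ g (seg C d c) = nu /\ h (seg C d c) = j.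

(** The sets on which guessing fails for some club form an ideal, shown below to be normal;
    [positive] means outside it. *)
Definition positive nu (X : K M -> Prop) : Prop :=
  forall D, club D -> exists d, X d /\ Aset C d /\ guesses D nu d.

Lemma guesses_mono (D D' : K M -> Prop) nu d v : lt v d -> (forall c, lt v c -> D c -> D' c) ->
  guesses D nu d -> guesses D' nu d.
Proof.
  intros Hv HD H j b Hb. destruct (max2_lt Hv Hb) as [u [Hu1 [Hu2 Hu]]].
  destruct (H j u Hu) as [c [Hc [H1 [H2 [H3 H4]]]]].
  exists c. repeat split; auto; [ord | apply H1 | apply H1 | apply HD; [ord | assumption]].
Qed.

Lemma nacc_lt d c : nacc (C d) c -> lt c d.
Proof. intros [H _]. now apply (C_lt Hsq). Qed.

Lemma positive_all nu : lt nu (muK M) -> positive nu (fun _ => True).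
Proof.
  intros Hnu D HD. destruct (HTheta HD Hnu) as [d [Hd H]]. exists d. repeat split; auto; try apply Hd.
  intros j b Hb. destruct (is_sup_approx (H j) Hb) as [c [[H1 [H2 [_ [o [Ho [H3 H4]]]]]] Hc]].
  exists c. unfold seg. rewrite (otp_eq Ho). auto.
Qed.

Lemma positive_mono nu (X Y : K M -> Prop) : (forall d, X d -> Y d) -> positive nu X -> positive nu Y.
Proof. intros H HX D HD. destruct (HX D HD) as [d [H1 H2]]. exists d. auto. Qed.

(** Guessing a club that lies above [b] forces [d] above [b]. *)
Lemma positive_above nu X b : positive nu X -> positive nu (fun d => X d /\ Aset C d /\ lt b d).
Proof.
  intros H D HD. destruct (H _ (club_above b HD)) as [d [H1 [H2 H3]]]. exists d.
  destruct (Aset_limit H2) as [[e He] _]. destruct (H3 0 e He) as [c [_ [Hc [[_ Hbc] _]]]].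
  apply nacc_lt in Hc. repeat split; auto; try apply H2; [ord|].
  apply guesses_mono with (v := e) (3 := H3); [assumption | tauto].
Qed.

Lemma positive_unbounded nu X : positive nu X -> unbounded X.
Proof.
  intros H b. destruct (positive_above b H (D := fun _ => True)) as [d [H1 _]].
  - split; [|trivial]. intros x. exists x. split; [apply ole_refl | trivial].
  - exists d. tauto.
Qed.

(** Normality. Were no class positive, each [v] would have a club witnessing this. A [d] that
    guesses their diagonal intersection also guesses the club of its own [v], since only points
    above [v] matter. *)
Lemma positive_press nu X (P : K M -> K M -> Prop) : positive nu X ->
  (forall d, X d -> Aset C d -> exists v, lt v d /\ P v d) -> exists v, positive nu (fun d => X d /\ P v d).
Proof.
  intros HX HP. apply NNPP. intros Hno.
  assert (HD : forall v, exists D, club D /\ ~ exists d, (X d /\ P v d) /\ Aset C d /\ guesses D nu d).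
  { intros v. apply NNPP. intros Hv. apply Hno. exists v. intros D HD. apply NNPP. intros H. apply Hv. eauto. }
  pose (D := fun v => epsilon (inhabits (fun _ : K M => True))
    (fun D => club D /\ ~ exists d, (X d /\ P v d) /\ Aset C d /\ guesses D nu d)).
  assert (HD' : forall v, club (D v) /\ ~ exists d, (X d /\ P v d) /\ Aset C d /\ guesses (D v) nu d).
  { intros v. unfold D. apply epsilon_spec, HD. }
  destruct (HX _ (club_diag (fun v => proj1 (HD' v)))) as [d [H1 [H2 H3]]].
  destruct (HP d H1 H2) as [v [Hv HPv]]. destruct (HD' v) as [_ H]. apply H.
  exists d. repeat split; auto; try apply H2. apply guesses_mono with (v := v) (3 := H3); auto.
Qed.

(** Above mu, an index coded below mu is a regressive choice, so pressing down applies. *)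
Lemma positive_pigeonhole nu X (I : Type) (A : I -> Prop) (P : I -> K M -> Prop) :
  small M A -> positive nu X -> (forall d, X d -> Aset C d -> exists i, A i /\ P i d) ->
  exists i, A i /\ positive nu (fun d => X d /\ P i d).
Proof.
  intros [e [He Ie]] HX HP.
  destruct (positive_press (P := fun v d => exists i, A i /\ e i = v /\ P i d) (positive_above (muK M) HX))
    as [v Hv].
  - intros d [H1 [H2 H3]] _. destruct (HP d H1 H2) as [i [Hi HPi]]. exists (e i). split; [|eauto].
    specialize (He i Hi). unfold below in He. ord.
  - destruct (positive_unbounded Hv (muK M)) as [d [[_ [i [Hi [E _]]]] _]].
    exists i. split; [assumption|]. apply positive_mono with (2 := Hv).
    intros d' [[H1 _] [i' [Hi' [E' H']]]]. split; [assumption|].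
    replace i with i'; [assumption|]. apply Ie; auto. congruence.
Qed.

Definition word := Forall (fun o : K M => lt o (muK M)).

Definition slot (m : nat) (w : list (K M)) : option (K M) :=
  option_map g (find (fun o => h o =? m) w).

Lemma slot_app_some m u v nu : slot m u = Some nu -> slot m (u ++ v) = Some nu.
Proof.
  unfold slot. induction u as [|a u IH]; simpl; [discriminate|].
  destruct (h a =? m); auto.
Qed.

Lemma slot_new m u v o : (forall o', In o' u -> h o' < m) -> h o = m -> slot m (u ++ o :: v) = Some (g o).
Proof.
  intros H Ho. unfold slot. induction u as [|a u IH]; simpl.
  - apply Nat.eqb_eq in Ho. now rewrite Ho.
  - replace (h a =? m) with false; [apply IH; intros; apply H; now right|].
    symmetry. apply Nat.eqb_neq. specialize (H a (or_introl eq_refl)). lia.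
Qed.

(** * Words of tuples through points of [Aset C] *)

Section Tuples.
Variables (n : nat) (S : (Fin.t n -> Node M) -> Prop).
Hypothesis S_nodes : forall x, S x -> forall k, Tnodes C (x k).
Hypothesis S_unbounded : forall b, exists x, S x /\ forall k, lt b (fst (x k)).

(** Expresses through values alone that the walks from the nodes of [x] to points between [e] and
    [d] go through [d], coordinate [k] having read [w k] by then. *)
Definition passes (w : Fin.t n -> list (K M)) d e (x : Fin.t n -> Node M) : Prop :=
  S x /\ lt e d /\ forall k, lt d (fst (x k)) /\ forall z, lt e z -> lt z d -> snd (x k) z = w k ++ rho0 C z d.

Lemma passes_mono w d e e' x : passes w d e x -> le e e' -> lt e' d -> passes w d e' x.
Proof.
  intros [H1 [H2 H3]] He Hd. repeat split; auto; [apply H3|]. intros z Hz Hzd. apply H3; ord.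
Qed.

Lemma passes_exists d : Aset C d ->
  exists w, (forall k, word (w k)) /\ exists e x, passes w d e x.
Proof.
  intros Hd. destruct (Aset_limit Hd) as [Hp _]. destruct (S_unbounded d) as [x [Hx Hxd]].
  exists (fun k => snd (x k) d).
  assert (H : forall k, word (snd (x k) d) /\ exists e, lt e d /\
    forall z, lt e z -> lt z d -> snd (x k) z = snd (x k) d ++ rho0 C z d).
  { intros k. destruct (S_nodes Hx k) as [u [d' [Hu E]]]. specialize (Hxd k). rewrite E in *. simpl in *.
    rewrite restrict_lt by assumption. assert (Hdd' : le d d') by ord. split; [now apply rho0_letters|].
    destruct (rho0_concat Hsq Hd Hdd') as [e [He H]]. exists e. split; [assumption|].
    intros z Hz Hzd. rewrite restrict_lt by ord. auto. }
  split; [apply H|]. destruct (fin_enumeration n) as [l [_ Hl]].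
  destruct (list_bound_below (l := l) (d := d) (P := fun k e => forall z, lt e z -> lt z d -> snd (x k) z = snd (x k) d ++ rho0 C z d))
    as [e [He H']].
  - assumption.
  - intros k e e' H1 H2 H3 z Hz Hzd. apply H1; ord.
  - intros k _. apply H.
  - exists e, x. repeat split; auto.
Qed.

Lemma passes_extend w d e x d1 : passes w d e x -> Aset C d1 -> lt e d1 -> lt d1 d ->
  exists e', passes (fun k => w k ++ rho0 C d1 d) d1 e' x.
Proof.
  intros [H1 [H2 H3]] Hd1 Hed1 Hd1d. destruct (rho0_concat Hsq Hd1 (olt_le Hd1d)) as [e1 [He1 H]].
  destruct (max2_lt Hed1 He1) as [e' [Hl1 [Hl2 He']]]. exists e'. split; [assumption|]. split; [assumption|].
  intros k. destruct (H3 k) as [H4 H5]. split; [ord|]. intros z Hz Hzd1.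
  rewrite H5, H by ord. now rewrite app_assoc.
Qed.

Definition reachable w d : Prop := exists e x, passes w d e x.

(** On a positive set [w] and [e] are constant. A guessing point [d] of it supplies a letter with
    [h]-value [j0] and [g]-value [nu], read on the way to another guessing point [d1]. As [j0]
    exceeds all [h]-values in [w], this letter is the first in its slot. *)
Lemma plant nu : lt nu (muK M) -> exists w j0, (forall k, word (w k)) /\
  (forall k, slot j0 (w k) = Some nu) /\ positive nu (reachable w).
Proof.
  intros Hnu.
  destruct (positive_pigeonhole (A := fun w : Fin.t n -> list (K M) => forall k, word (w k))
    (P := reachable) (small_tuples n words_small) (positive_all Hnu)) as [w [Hw H0]].
  { intros d _ Hd. destruct (passes_exists Hd) as [w Hw]. exists w. exact Hw. }
  destruct (positive_press (P := fun e d => exists x, passes w d e x) H0) as [e H1].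
  { intros d [_ [e [x Hx]]] _. exists e. split; [apply Hx | eauto]. }
  destruct (fin_max (fun k => list_max (map h (w k)))) as [N HN].
  pose (j0 := Datatypes.S N).
  assert (Hj0 : forall k o, In o (w k) -> h o < j0).
  { intros k o Ho. specialize (HN k). apply list_max_le in HN. rewrite Forall_map, Forall_forall in HN.
    specialize (HN o Ho). unfold j0. lia. }
  assert (H2 : positive nu (fun d => exists w', (forall k, word (w' k)) /\
    (forall k, slot j0 (w' k) = Some nu) /\ reachable w' d)).
  { intros D HD.
    (* [G] finds guessing points above any bound, so a closure point [c] of [G] has such points
       arbitrarily close below it. *)
    pose (G := fun b => epsilon (inhabits b) (fun d => lt b d /\ Aset C d /\ guesses D nu d)).
    assert (HG : forall b, lt b (G b) /\ Aset C (G b) /\ guesses D nu (G b)).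
    { intros b. unfold G. apply epsilon_spec.
      destruct (positive_above b (positive_all Hnu) HD) as [d [H2 [H3 H4]]]. exists d. tauto. }
    destruct (H1 _ (club_closure G)) as [d [[_ [x Hx]] [Hd Hgd]]].
    assert (Hed : lt e d) by apply Hx.
    destruct (Hgd j0 e Hed) as [c [Hec [Hc [HDc [Hgc Hhc]]]]].
    assert (Hcd := nacc_lt Hc). assert (Hpc : pos c) by now exists e.
    destruct (rho0_nacc Hsq Hc Hpc) as [e1 [He1 Hn]].
    destruct (max2_lt Hec He1) as [b [Hb1 [Hb2 Hb]]].
    destruct (HG b) as [H2 [H3 H4]]. specialize (HDc b Hb). set (d1 := G b) in *.
    exists d1. split; [|auto]. exists (fun k => w k ++ rho0 C d1 d). split; [|split].
    - intros k. apply Forall_app. split; [apply Hw|]. apply rho0_letters; [assumption | now exists b | left; ord].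
    - intros k. rewrite Hn, <- Hgc by ord. now apply slot_new; [apply Hj0|].
    - destruct (passes_extend Hx H3) as [e' He']; [ord | ord|]. exists e', x. assumption. }
  destruct (positive_pigeonhole (A := fun w' => forall k, word (w' k))
    (P := fun w' d => (forall k, slot j0 (w' k) = Some nu) /\ reachable w' d) (small_tuples n words_small) H2)
    as [w' [Hw' H3]].
  { intros d [w' [Hw1 [Hw2 Hw3]]] _. eauto. }
  exists w', j0. split; [assumption|]. split.
  - destruct (positive_unbounded H3 nu) as [d Hd]. tauto.
  - apply positive_mono with (2 := H3). tauto.
Qed.

(** Descending from [d] to a lower point [d1] appends the same nonempty word [rho0 C d1 d] to all
    coordinates; the pigeonhole principle makes this word constant on a positive set. *)
Lemma lengthen nu X w N : positive nu X -> (forall d, X d -> reachable w d) ->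
  exists Y r, word r /\ N <= length r /\ (forall d, Y d -> X d) /\ positive nu Y /\
    forall d, Y d -> reachable (fun k => w k ++ r) d.
Proof.
  intros HX Hw. induction N as [|N [Y [r [Hr [HN [HYX [HY HYr]]]]]]].
  - exists X, nil. repeat split; auto; [constructor|]. intros d Hd.
    replace (fun k => w k ++ nil) with w; [auto|].
    apply functional_extensionality. intros k. now rewrite app_nil_r.
  - destruct (positive_press (P := fun e d => exists x, passes (fun k => w k ++ r) d e x) HY) as [e He].
    { intros d Hd _. destruct (HYr d Hd) as [e [x Hx]]. exists e. split; [apply Hx | eauto]. }
    destruct (positive_pigeonhole (A := word)
      (P := fun r' d => 0 < length r' /\ reachable (fun k => w k ++ (r ++ r')) d)
      (words_small) (positive_above e HY)) as [r' [Hr' HP]].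
    + intros d1 [H1 [H2 H3]] _. destruct (positive_unbounded He d1) as [d [[H4 [x Hx]] Hd]].
      exists (rho0 C d1 d). destruct (Aset_limit H2) as [Hp _]. split; [apply rho0_letters; auto using olt_le|].
      split; [rewrite rho0_cons by assumption; simpl; lia|].
      destruct (passes_extend Hx H2 H3 Hd) as [e' He']. exists e', x.
      replace (fun k => w k ++ r ++ rho0 C d1 d) with (fun k => (w k ++ r) ++ rho0 C d1 d); [assumption|].
      apply functional_extensionality. intros k. now rewrite app_assoc.
    + destruct (positive_unbounded HP e) as [d0 [[_ [Hl _]] _]].
      exists (fun d => (Y d /\ Aset C d /\ lt e d) /\ 0 < length r' /\ reachable (fun k => w k ++ (r ++ r')) d), (r ++ r').
      repeat split; auto.
      * apply Forall_app. auto.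
      * rewrite length_app. lia.
      * intros d H. apply HYX, H.
      * intros d H. apply H.
Qed.

(** Each new suffix is attached to [w] itself and is longer than the ranks of all earlier words,
    while the positive set shrinks. *)
Lemma lengthen_many nu X w (rank : list (K M) -> nat) q : positive nu X -> (forall d, X d -> reachable w d) ->
  exists Y (r : nat -> list (K M)), (forall d, Y d -> X d) /\ positive nu Y /\
    (forall i i' k, i < i' -> i' < q -> rank (w k ++ r i) < length (r i')) /\
    forall d i, Y d -> i < q -> reachable (fun k => w k ++ r i) d.
Proof.
  intros HX Hw. induction q as [|q [Y [r [H1 [H2 [H3 H4]]]]]].
  - exists X, (fun _ => nil). repeat split; auto; intros; lia.
  - assert (HN : exists N, forall i k, i < q -> rank (w k ++ r i) <= N).
    { clear. induction q as [|q [N HN]]; [exists 0; intros; lia|].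
      destruct (fin_max (fun k => rank (w k ++ r q))) as [N' HN']. exists (N + N'). intros i k Hi.
      destruct (Nat.eq_dec i q) as [-> | Hne]; [specialize (HN' k); lia|].
      specialize (HN i k). lia. }
    destruct HN as [N HN].
    destruct (lengthen (Datatypes.S N) H2 (fun d Hd => Hw d (H1 d Hd))) as [Z [r' [_ [Hl [HZ1 [HZ2 HZ3]]]]]].
    exists Z, (fun i => if i =? q then r' else r i). split; [auto|]. split; [assumption|]. split.
    + intros i i' k Hi Hi'. assert (Ei : i =? q = false) by (apply Nat.eqb_neq; lia). rewrite Ei.
      destruct (Nat.eqb_spec i' q) as [-> | Hne]; [specialize (HN i k Hi); lia | apply H3; lia].
    + intros d i Hd Hi. destruct (Nat.eqb_spec i q) as [-> | Hne]; [auto | apply H4; [auto | lia]].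
Qed.

(** The finitely many bounds belonging to [d] have a common one below [d], and pressing down makes
    it independent of [d]. *)
Lemma lengthen_uniform nu X w (rank : list (K M) -> nat) q : positive nu X -> (forall d, X d -> reachable w d) ->
  exists Y (r : nat -> list (K M)) e (xs : nat -> K M -> Fin.t n -> Node M), positive nu Y /\
    (forall i i' k, i < i' -> i' < q -> rank (w k ++ r i) < length (r i')) /\
    forall d i, Y d -> i < q -> passes (fun k => w k ++ r i) d e (xs i d).
Proof.
  intros HX Hw. destruct (lengthen_many rank q HX Hw) as [Y [r [_ [H2 [H3 H4]]]]].
  destruct (positive_press (P := fun e d => forall i, In i (seq 0 q) -> exists x, passes (fun k => w k ++ r i) d e x) H2)
    as [e He].
  - intros d Hd HA. apply list_bound_below.
    + now apply (Aset_limit HA).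
    + intros i e e' [x Hx] Hle Hlt. exists x. now apply passes_mono with e.
    + intros i Hi. apply in_seq in Hi. destruct (H4 d i Hd) as [e [x Hx]]; [lia|].
      exists e. split; [apply Hx | eauto].
  - exists (fun d => Y d /\ forall i, In i (seq 0 q) -> exists x, passes (fun k => w k ++ r i) d e x), r, e.
    exists (fun i d => epsilon (inhabits (fun _ => (d, fun _ => nil))) (passes (fun k => w k ++ r i) d e)).
    split; [assumption|]. split; [assumption|]. intros d i [_ Hd] Hi. apply epsilon_spec, Hd, in_seq. lia.
Qed.

Lemma level_of_tuple x k z : S x -> lt z (fst (x k)) ->
  exists d, le z d /\ restrict (snd (x k)) z = restrict (fun x => rho0 C x d) z.
Proof.
  intros Hx Hz. destruct (S_nodes Hx k) as [u [d [Hu E]]]. rewrite E in *. simpl in *.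
  exists d. split; [ord|]. apply restrict_ext. intros y Hy. now rewrite restrict_lt by ord.
Qed.

(* At each level [z] there are few possible data, and data shared by unboundedly many [d] in [Y] are shared by two
   of them on different branches, as there is no cofinal branch; [D] consists of closure points of a bound for
   such pairs.  Given [d], one member of the pair differs from [d]. *)
Lemma shadow_club (Y : K M -> Prop) (q : nat) (xs : nat -> K M -> Fin.t n -> Node M) :
  (forall d i, Y d -> i < q -> S (xs i d) /\ forall k, lt d (fst (xs i d k))) ->
  exists D, club D /\ forall c, D c ->
    (forall z, lt z c -> exists z', lt z z' /\ lt z' c) /\
    forall d z, Y d -> lt z c -> lt c d -> exists d', Y d' /\ lt z d' /\ lt d' c /\
      (exists x, pos x /\ lt x d' /\ rho0 C x d <> rho0 C x d') /\
      restrict (fun x => rho0 C x d) z = restrict (fun x => rho0 C x d') z /\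
      forall i k, i < q -> restrict (snd (xs i d k)) z = restrict (snd (xs i d' k)) z.
Proof.
  intros Hxs. destruct (fin_enumeration n) as [l [_ Hl]].
  pose (v := fun d z => (restrict (fun x => rho0 C x d) z,
     map (fun p => restrict (snd (xs (fst p) d (snd p))) z) (list_prod (seq 0 q) l))).
  pose (V := fun z u => exists d, Y d /\ lt z d /\ u = v d z).
  assert (HV : forall z, small M (V z)).
  { intros z. pose proof (level_small Hsq z) as Hlev.
    apply small_sub with (2 := small_prod Hlev (small_list Hlev)).
    intros u [d [Hd [Hz ->]]]. simpl. split; [exists d; split; [now left | reflexivity]|].
    apply Forall_map, Forall_forall. intros [i k] Hi. apply in_prod_iff in Hi. destruct Hi as [Hi _].
    apply in_seq in Hi. destruct (Hxs d i Hd) as [HS Hdom]; [lia|]. simpl.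
    apply level_of_tuple; [assumption|]. specialize (Hdom k). ord. }
  pose (Bd := fun z u b =>
    (exists d1 d2 x, (Y d1 /\ lt z d1 /\ lt d1 b /\ v d1 z = u) /\ (Y d2 /\ lt z d2 /\ lt d2 b /\ v d2 z = u) /\
       pos x /\ lt x d1 /\ lt x d2 /\ rho0 C x d1 <> rho0 C x d2) \/
    (forall d, Y d -> lt z d -> v d z = u -> le d b)).
  assert (HBd : forall z u, exists b, Bd z u b).
  { intros z u. destruct (classic (unbounded (fun d => Y d /\ lt z d /\ v d z = u))) as [Hu | Hu].
    - destruct (no_branch Hsq Hu) as [d1 [d2 [x [H1 [H2 [H3 [H4 [H5 H6]]]]]]]].
      destruct (bound2 d1 d2) as [b [Hb1 Hb2]]. exists b. left. exists d1, d2, x. tauto.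
    - destruct (not_unbounded Hu) as [b Hb]. exists b. right. intros. apply Hb. auto. }
  pose (bd := fun z u => epsilon (inhabits z) (Bd z u)).
  assert (Hbd : forall z u, Bd z u (bd z u)) by (intros z u; apply epsilon_spec, HBd).
  assert (HG : forall z, exists b, lt z b /\ forall u, V z u -> lt (bd z u) b).
  { intros z. destruct (small_family_bounded (bd z) (HV z)) as [b Hb].
    destruct (bound2 z b) as [b' [H1 H2]]. exists b'. split; [assumption|].
    intros u Hu. apply Hb in Hu. ord. }
  pose (G := fun z => epsilon (inhabits z) (fun b => lt z b /\ forall u, V z u -> lt (bd z u) b)).
  assert (HG' : forall z, lt z (G z) /\ forall u, V z u -> lt (bd z u) (G z)) by (intros z; unfold G; apply epsilon_spec, HG).
  exists (fun c => forall z, lt z c -> lt (G z) c). split; [apply club_closure|].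
  intros c Hc. split.
  { intros z Hz. exists (G z). split; [apply HG' | auto]. }
  intros d z Hd Hz Hcd. assert (Hzd : lt z d) by ord.
  destruct (HG' z) as [_ Hb]. specialize (Hb (v d z)). specialize (Hc z Hz).
  assert (Hlt : lt (bd z (v d z)) c) by (assert (lt (bd z (v d z)) (G z)) by (apply Hb; exists d; auto); ord).
  assert (Hfin : forall d', Y d' -> lt z d' -> lt d' (bd z (v d z)) -> v d' z = v d z ->
    (exists x, pos x /\ lt x d' /\ rho0 C x d <> rho0 C x d') ->
    exists d', Y d' /\ lt z d' /\ lt d' c /\
      (exists x, pos x /\ lt x d' /\ rho0 C x d <> rho0 C x d') /\
      restrict (fun x => rho0 C x d) z = restrict (fun x => rho0 C x d') z /\
      forall i k, i < q -> restrict (snd (xs i d k)) z = restrict (snd (xs i d' k)) z).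
  { intros d' H1 H2 H3 E H4. exists d'. injection E as E1 E2. repeat split; auto; [ord|].
    intros i k Hi. pose proof (ext_in_map E2 (i, k)) as E3. simpl in E3. symmetry. apply E3.
    apply in_prod; [apply in_seq; lia | apply Hl]. }
  destruct (Hbd z (v d z)) as [[d1 [d2 [x [[A1 [A2 [A3 A4]]] [[B1 [B2 [B3 B4]]] [Hx [Hx1 [Hx2 Hne]]]]]]]] | Hno].
  - destruct (classic (rho0 C x d = rho0 C x d1)) as [E | E].
    + apply (Hfin d2); auto. exists x. rewrite E. auto.
    + apply (Hfin d1); auto. exists x. auto.
  - specialize (Hno d Hd Hzd eq_refl). exfalso. ord.
Qed.

(** * The base colour, and splitting all coordinates at one height *)

Section Colour.
Variables (sel : list nat -> nat) (q : nat -> nat) (rank : list nat -> nat).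
Hypothesis size_le_rank : forall w, length w <= rank w.
Hypothesis sel_spec : forall j0 (W : nat -> list (list nat)),
  (forall i, i < q j0 -> length (W i) <= n) ->
  (forall i i', i < i' -> i' < q j0 -> forall w w', In w (W i) -> In w' (W i') -> rank w < rank w') ->
  exists j, forall p, exists i, i < q j0 /\ forall w, In w (W i) -> sel (w ++ j :: p) = j0.

Definition word_colour (w : list (K M)) : K M :=
  match slot (sel (map h w)) w with Some nu => nu | None => muK M end.

Definition base_colour (t : Node M) : K M :=
  word_colour (epsilon (inhabits nil) (stable_prefix (fst t) (snd t))).

Lemma base_colour_eq t p : stable_prefix (fst t) (snd t) p -> base_colour t = word_colour p.
Proof.
  intros H. unfold base_colour. f_equal. apply (@stable_prefix_unique M (fst t) (snd t)); [|assumption].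
  apply epsilon_spec. eauto.
Qed.

(** The tuples [xs i d] and [xs i d'] split where [rho0] of [d] and of [d'] first differ. There the
    stable prefix of coordinate [k] is [w k ++ r i], then the letter with [h]-value [j], then a word
    [p] depending only on [c] and [z]. Only now is [i] fixed, so that [sel] yields [j0], whose slot
    holds [nu]. *)
Lemma common_meet nu : lt nu (muK M) -> exists x y z, S x /\ S y /\ forall k,
  lt z (fst (x k)) /\ lt z (fst (y k)) /\ (forall u, lt u z -> snd (x k) u = snd (y k) u) /\
  snd (x k) z <> snd (y k) z /\ base_colour (z, restrict (snd (x k)) z) = nu.
Proof.
  intros Hnu. destruct (plant Hnu) as [w [j0 [Hw [Hslot H0]]]].
  destruct (lengthen_uniform (fun u => rank (map h u)) (q j0) H0 (fun d H => H)) as [Y [r [e [xs [HY [Hrank Hxs]]]]]].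
  destruct (fin_enumeration n) as [l [Hlen Hl]].
  (* [j] is fixed before [z] and [p] are known; it serves every suffix through one of the [q j0]
     groups. *)
  destruct (@sel_spec j0 (fun i => map (fun k => map h (w k ++ r i)) l)) as [j Hj].
  { intros i _. rewrite length_map. lia. }
  { intros i i' Hi Hi' u u' Hu Hu'. apply in_map_iff in Hu, Hu'.
    destruct Hu as [k [<- _]]. destruct Hu' as [k' [<- _]].
    specialize (Hrank i i' k Hi Hi'). specialize (size_le_rank (map h (w k' ++ r i'))).
    rewrite length_map, length_app in size_le_rank. lia. }
  destruct (@shadow_club Y (q j0) xs) as [D [HD HDs]].
  { intros d i Hd Hi. destruct (Hxs d i Hd Hi) as [H1 [_ H2]]. split; [assumption|]. apply H2. }
  destruct (HY D HD) as [d [Hd [HdA Hgd]]].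
  destruct (Nat.eq_dec (q j0) 0) as [Eq0 | Hq0].
  { exfalso. destruct (Hj nil) as [i [Hi _]]. lia. }
  assert (Hed : lt e d) by (apply (Hxs d 0 Hd); lia).
  destruct (Hgd j e Hed) as [c [Hec [Hc [HDc [_ Hhc]]]]].
  assert (Hcd := nacc_lt Hc). assert (Hpc : pos c) by now exists e.
  destruct (rho0_nacc Hsq Hc Hpc) as [e1 [He1 Hn]].
  destruct (HDs c HDc) as [Hlim Hsh].
  destruct (max2_lt Hec He1) as [b0 [Hb1 [Hb2 Hb0]]].
  (* Room is left above [b0], so that the factorizations through [d], [d'] and [c] are all valid
     from [b] on. *)
  destruct (Hlim b0 Hb0) as [b [Hb0b Hb]]. destruct (Hlim b Hb) as [z0 [Hbz0 Hz0]].
  destruct (Hsh d z0 Hd Hz0 Hcd) as [d' [Hd' [Hz0d' [Hd'c [[x0 [Hx0p [Hx0 Hne0]]] [Er Exs]]]]]].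
  destruct (@least_exists M (fun x => lt x d' /\ rho0 C x d <> rho0 C x d')) as [z [[Hzd' Hne] Hmin]]; [eauto|].
  assert (Hz : le z0 z).
  { apply not_olt. intros Hl'. apply Hne. exact (restrict_eq Er Hl'). }
  assert (Hsame : forall u, lt u z -> rho0 C u d = rho0 C u d').
  { intros u Hu. apply NNPP. intros Hne'. assert (le z u); [|ord]. apply Hmin. split; [ord | assumption]. }
  assert (Hzp : pos z) by (exists b; ord). assert (Hzc : le z c) by ord.
  destruct (stable_prefix_exists Hsq Hzp Hzc) as [p Hp].
  destruct (Hj (map h p)) as [i [Hi Hsel]].
  destruct (Hxs d i Hd Hi) as [H1 [_ H2]]. destruct (Hxs d' i Hd' Hi) as [H1' [_ H2']].
  exists (xs i d), (xs i d'), z. split; [assumption|]. split; [assumption|]. intros k.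
  destruct (H2 k) as [H3 H4]. destruct (H2' k) as [H3' H4'].
  split; [ord|]. split; [ord|]. split; [|split].
  - intros u Hu. destruct (olt_or_ole u z0) as [Hu0 | Hu0]; [exact (restrict_eq (Exs i k Hi) Hu0)|].
    rewrite H4, H4', Hsame by ord. reflexivity.
  - rewrite H4, H4' by ord. intros E. apply app_inv_head in E. contradiction.
  - assert (Hsp : stable_prefix z (restrict (snd (xs i d k)) z) (((w k ++ r i) ++ seg C d c :: nil) ++ p)).
    { apply stable_prefix_app with (g := fun x => rho0 C x c) (e := b); [ord| |assumption].
      intros u Hu Huz. rewrite restrict_lt, H4, Hn by ord. now rewrite <- !app_assoc. }
    rewrite (@base_colour_eq (z, _) _ Hsp). unfold word_colour.
    rewrite <- app_assoc, map_app. cbn [app map]. rewrite Hhc, Hsel.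
    + rewrite <- app_assoc, (slot_app_some _ (Hslot k)). reflexivity.
    + apply in_map_iff. exists k. auto.
Qed.

End Colour.
End Tuples.
End Guessing.

(** * Decoding colours *)

Section Decoding.
Context {M : SuccCard}.

Lemma codes_exist : exists code : K M -> K M -> K M, (forall a x, lt (code a x) (muK M)) /\
  forall a x y, lt x a -> lt y a -> code a x = code a y -> x = y.
Proof.
  destruct (mu_infinite M) as [e [He _]].
  pose (Q := fun a (f : K M -> K M) => (forall x, lt (f x) (muK M)) /\
    forall x y, lt x a -> lt y a -> f x = f y -> x = y).
  assert (HQ : forall a, exists f, Q a f).
  { intros a. destruct (small_below a) as [f [Hf If]].
    exists (fun x => if excluded_middle_informative (lt x a) then f x else e 0). split.
    - intros x. destruct excluded_middle_informative; [now apply Hf | now apply He].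
    - intros x y Hx Hy. destruct excluded_middle_informative; [|contradiction].
      destruct excluded_middle_informative; [|contradiction]. now apply If. }
  exists (fun a => epsilon (inhabits (fun _ => muK M)) (Q a)).
  split; intros a; apply (epsilon_spec (inhabits (fun _ => muK M)) _ (HQ a)).
Qed.

(** Diagonalization by recursion: [P a] holds at [code a x] exactly when [P x] fails there. A single
    bit, at an ordinal below mu, thus separates [a] from a given smaller [b]. *)
Lemma separating_predicate (code : K M -> K M -> K M) :
  (forall a x y, lt x a -> lt y a -> code a x = code a y -> x = y) ->
  exists P : K M -> K M -> Prop, forall a b, lt b a -> (P a (code a b) <-> ~ P b (code a b)).
Proof.
  intros Hcode.
  pose (F := fun a (rec : forall x, lt x a -> K M -> Prop) u => exists x (r : lt x a), code a x = u /\ ~ rec x r u).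
  pose (P := Fix olt_wf (fun _ => K M -> Prop) F).
  assert (EP : forall a, P a = F a (fun x _ => P x)).
  { intros a. unfold P at 1. rewrite Fix_eq; [reflexivity|].
    intros z u v E. replace v with u; [reflexivity|].
    apply functional_extensionality_dep. intro y. apply functional_extensionality_dep. intro r. apply E. }
  exists P. intros a b Hb. rewrite (EP a). unfold F. split.
  - intros [x [r [E H]]]. apply Hcode in E; auto. now subst x.
  - intros H. now exists b, Hb.
Qed.

Lemma small_decoder X (x0 : X) (A : X -> Prop) : small M A ->
  exists dec : K M -> X, forall x, A x -> exists r, lt r (muK M) /\ dec r = x.
Proof.
  intros [f [Hf If]]. exists (fun r => epsilon (inhabits x0) (fun x => A x /\ f x = r)).
  intros x Hx. exists (f x). split; [now apply Hf|].
  destruct (epsilon_spec (inhabits x0) (fun y => A y /\ f y = f x)) as [H1 H2]; eauto.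
Qed.

Definition next (z : K M) : K M := least (lt z).

Lemma next_spec z : lt z (next z) /\ forall x, lt x (next z) -> le x z.
Proof.
  destruct (least_spec (succ_exists z)) as [H1 H2]. split; [exact H1|].
  intros x Hx. apply not_olt. intros Hz. specialize (H2 x Hz). unfold next in Hx. ord.
Qed.

Variable C : K M -> K M -> Prop.
Hypothesis Hsq : square_star C.

Definition level z (s : K M -> list (K M)) : Prop :=
  exists d, le z d /\ s = restrict (fun x => rho0 C x d) z.

Lemma level_restrict z u s : le z u -> level u s -> level z (restrict s z).
Proof.
  intros Hz [d [Hd ->]]. exists d. split; [ord|]. apply restrict_ext.
  intros x Hx. now rewrite restrict_lt by ord.
Qed.

Lemma Tnodes_level t : Tnodes C t -> level (fst t) (snd t).
Proof. intros [u [d [Hu ->]]]. exists d. auto. Qed.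

Lemma restrict_restrict (f : K M -> list (K M)) z u : le z u -> restrict (restrict f u) z = restrict f z.
Proof. intros H. apply restrict_ext. intros x Hx. now rewrite restrict_lt by ord. Qed.

Variables (P : K M -> K M -> Prop) (dec : K M -> list (list (K M)) * list (K M * bool) * K M)
  (dec_level : K M -> K M -> list ((K M -> list (K M)) * K M)).

Definition marks (t : Node M) (Qs : list (list (K M))) (flags : list (K M * bool)) (z : K M) : Prop :=
  pos z /\ lt z (fst t) /\ In (snd t z) Qs /\ forall u b, In (u, b) flags -> (P z u <-> b = true).

(** A colour unpacks to words, flags and the code of a table. Words and flags locate a level [z];
    the table assigns colours to nodes of height [next z]. *)
Definition decode (t : Node M) (nu : K M) : K M :=
  let z := least (marks t (fst (fst (dec nu))) (snd (fst (dec nu)))) in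
  epsilon (inhabits nu) (fun a => In (restrict (snd t) (next z), a) (dec_level z (snd (dec nu)))).

Variable code : K M -> K M -> K M.
Hypothesis code_lt : forall a x, lt (code a x) (muK M).
Hypothesis P_spec : forall a b, lt b a -> (P a (code a b) <-> ~ P b (code a b)).
Hypothesis dec_spec : forall Qs flags r, Forall word Qs -> Forall (fun f => lt (fst f) (muK M)) flags ->
  lt r (muK M) -> exists nu, lt nu (muK M) /\ dec nu = (Qs, flags, r).
Hypothesis dec_level_spec : forall z l, Forall (fun p => level (next z) (fst p) /\ lt (snd p) z) l ->
  exists r, lt r (muK M) /\ dec_level z r = l.

(* [nu] describes the level [z] to every node through some [s k]: it is the least level where the node takes a value in
   [Qs] and agrees with [flags]; the colours of the [s k] are then read off a code relative to that level. *)
Lemma decode_spec n (s : Fin.t n -> K M -> list (K M)) (tau : Fin.t n -> K M) z : pos z ->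
  (forall k, level (next z) (s k)) -> (forall k, lt (tau k) z) -> (forall k k', s k = s k' -> tau k = tau k') ->
  exists nu, lt nu (muK M) /\ forall t k, lt z (fst t) -> restrict (snd t) (next z) = s k -> decode t nu = tau k.
Proof.
  intros Hz Hs Htau Hst. destruct (fin_enumeration n) as [l [_ Hl]]. destruct (next_spec z) as [Hzn Hnz].
  pose (Qs := map (fun k => s k z) l).
  (* The only rival of [z] for a pair of indices: by injectivity of [rho0], the first node takes the
     value of the second one at [z] at most once among the nonzero points below [z]. *)
  pose (hit := fun p : Fin.t n * Fin.t n =>
    epsilon (inhabits z) (fun y => pos y /\ lt y z /\ s (fst p) y = s (snd p) z)).
  pose (flag := fun u => (u, if excluded_middle_informative (P z u) then true else false)).
  pose (flags := map (fun p => flag (code z (hit p))) (list_prod l l)).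
  destruct (@dec_level_spec z (map (fun k => (s k, tau k)) l)) as [r [Hr Er]].
  { apply Forall_map, Forall_forall. intros k _. split; [apply Hs | apply Htau]. }
  destruct (@dec_spec Qs flags r) as [nu [Hnu Enu]].
  { apply Forall_map, Forall_forall. intros k _. destruct (Hs k) as [d [Hd ->]].
    rewrite restrict_lt by assumption. apply (rho0_letters Hsq); [assumption | ord]. }
  { apply Forall_map, Forall_forall. intros p _. apply code_lt. }
  { assumption. }
  exists nu. split; [assumption|]. intros t k Hzt Ht.
  assert (Hv : forall x, le x z -> snd t x = s k x).
  { intros x Hx. rewrite <- Ht, restrict_lt; [reflexivity | ord]. }
  assert (Ez : least (marks t Qs flags) = z).
  { apply least_eq.
    - split; [assumption|]. split; [assumption|]. split.
      + rewrite Hv by apply ole_refl. apply in_map_iff. eauto.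
      + intros u b H. apply in_map_iff in H. destruct H as [p [E _]]. unfold flag in E.
        injection E as <- <-. destruct excluded_middle_informative; intuition congruence.
    - intros y [Hy [_ [HyQ Hyf]]]. apply not_olt. intros Hyz.
      apply in_map_iff in HyQ. destruct HyQ as [k' [Ek' _]]. rewrite Hv in Ek' by now left.
      assert (Ehit : hit (k, k') = y).
      { assert (Hex : exists y, pos y /\ lt y z /\ s k y = s k' z) by (exists y; auto).
        destruct (epsilon_spec (inhabits z) _ Hex : pos (hit (k, k')) /\ lt (hit (k, k')) z /\ s k (hit (k, k')) = s k' z)
          as [H1 [H2 H3]].
        destruct (Hs k) as [d [Hd Es]]. assert (E : s k (hit (k, k')) = s k y) by congruence.
        rewrite Es, !restrict_lt in E by ord.
        apply (rho0_inj Hsq) in E; auto; left; ord. }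
      destruct (flag (code z y)) as [u b] eqn:Ef.
      assert (Hin : In (u, b) flags).
      { rewrite <- Ef, <- Ehit. apply (in_map (fun p => flag (code z (hit p)))). now apply in_prod. }
      (* The rival [y] violates the flag at [code z y], where [P y] and [P z] disagree. *)
      specialize (Hyf u b Hin). pose proof (P_spec Hyz) as HP. unfold flag in Ef. injection Ef as Eu Eb.
      rewrite Eu in *. destruct excluded_middle_informative in Eb; subst b; intuition congruence. }
  unfold decode. rewrite Enu. cbn [fst snd]. rewrite Ez, Er, Ht.
  assert (Hex : exists a, In (s k, a) (map (fun k => (s k, tau k)) l)).
  { exists (tau k). apply in_map_iff. exists k. auto. }
  apply (epsilon_spec (inhabits nu)) in Hex. apply in_map_iff in Hex. destruct Hex as [k' [E _]].
  injection E as E1 E2. rewrite <- E2. now apply Hst.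
Qed.

End Decoding.

(** There are at most mu triples of words, flags and a code and, for a fixed [z], at most mu tables
    of nodes with colours below [z]; both are therefore coded by ordinals below mu. *)
Lemma decoder_exists {M : SuccCard} (C : K M -> K M -> Prop) : square_star C -> exists decode : Node M -> K M -> K M,
  forall n (s : Fin.t n -> K M -> list (K M)) (tau : Fin.t n -> K M) z, pos z ->
  (forall k, level C (next z) (s k)) -> (forall k, lt (tau k) z) -> (forall k k', s k = s k' -> tau k = tau k') ->
  exists nu, lt nu (muK M) /\ forall t k, lt z (fst t) -> restrict (snd t) (next z) = s k -> decode t nu = tau k.
Proof.
  intros Hsq. destruct (@codes_exist M) as [code [Hc1 Hc2]].
  destruct (separating_predicate Hc2) as [P HP].
  assert (Hd : small M (fun d : list (list (K M)) * list (K M * bool) * K M =>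
    (Forall word (fst (fst d)) /\ Forall (fun f => lt (fst f) (muK M) /\ True) (snd (fst d))) /\ lt (snd d) (muK M))).
  { apply small_prod with (A := fun d => Forall word (fst d) /\ Forall (fun f => lt (fst f) (muK M) /\ True) (snd d))
      (B := below lt (muK M)); [|apply small_below].
    apply small_prod with (A := Forall word) (B := Forall _); apply small_list; [apply words_small|].
    apply small_prod with (A := below lt (muK M)) (B := fun _ => True); [apply small_below|].
    apply small_image with (f := fun n => n =? 0) (A := fun _ : nat => True); [|apply small_nat].
    intros [|] _; [exists 0 | exists 1]; auto. }
  destruct (small_decoder (nil, nil, muK M) Hd) as [dec Hdec].
  assert (Hl : forall z, exists dl, forall l, Forall (fun p => level C (next z) (fst p) /\ lt (snd p) z) l ->
    exists r, lt r (muK M) /\ dl r = l).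
  { intros z. apply (small_decoder nil). apply small_list.
    apply small_prod with (A := level C (next z)) (B := below lt z); [apply (level_small Hsq) | apply small_below]. }
  pose (dl := fun z => epsilon (inhabits (fun _ => nil)) (fun dl => forall l,
    Forall (fun p => level C (next z) (fst p) /\ lt (snd p) z) l -> exists r, lt r (muK M) /\ dl r = l)).
  exists (decode P dec dl). intros n s tau z.
  apply (decode_spec Hsq) with (code := code); auto.
  - intros Qs flags r H1 H2 H3. apply (Hdec (Qs, flags, r)). repeat split; auto.
    revert H2. apply Forall_impl. auto.
  - intros z'. unfold dl. apply epsilon_spec, Hl.
Qed.

(** * Tuples of nodes, meets and rapid sets *)

Section Tuples.
Context {M : SuccCard} (C : K M -> K M -> Prop).
Hypothesis Hsq : square_star C.

Lemma pigeonhole_tuples n (S : (Fin.t n -> Node M) -> Prop) z :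
  (forall x, S x -> forall k, Tnodes C (x k)) ->
  (forall b, exists x, S x /\ forall k, lt b (fst (x k))) ->
  exists s, (forall k, level C z (s k)) /\
    forall b, exists x, (S x /\ forall k, lt z (fst (x k)) /\ restrict (snd (x k)) z = s k) /\ forall k, lt b (fst (x k)).
Proof.
  intros HT HS.
  pose (x := fun b => epsilon (inhabits (fun _ => (b, fun _ => nil))) (fun x => S x /\ forall k, lt b (fst (x k)))).
  assert (Hx : forall b, S (x b) /\ forall k, lt b (fst (x b k))) by (intros b; unfold x; apply epsilon_spec, HS).
  destruct (unbounded_pigeonhole (I := fun s => forall k, level C z (s k)) (B := lt z)
    (P := fun s b => forall k, restrict (snd (x b k)) z = s k) (small_tuples n (level_small Hsq z))) as [s [Hs Hu]].
  - intros b. destruct (bound2 z b) as [c Hc]. exists c. exact Hc.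
  - intros b Hb. exists (fun k => restrict (snd (x b k)) z). split; [|reflexivity].
    intros k. destruct (Hx b) as [HSb Hbk]. specialize (Hbk k).
    apply level_restrict with (u := fst (x b k)); [ord|]. now apply Tnodes_level, HT.
  - exists s. split; [assumption|]. intros b. destruct (Hu b) as [c [[Hzc Hc] Hbc]].
    destruct (Hx c) as [HSc Hck]. exists (x c).
    split; [|intros k; specialize (Hck k); ord].
    split; [assumption|]. intros k. specialize (Hck k). split; [ord | apply Hc].
Qed.

Lemma rapid_eq n (S : (Fin.t n -> Node M) -> Prop) x y k : rapid S -> S x -> S y ->
  fst (x k) = fst (y k) -> x = y.
Proof.
  intros HR Hx Hy E. apply NNPP. intros Hne.
  destruct (HR x y Hx Hy) as [H | H].
  - intros H. apply Hne. now apply functional_extensionality.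
  - specialize (H k k). rewrite E in H. ord.
  - specialize (H k k). rewrite E in H. ord.
Qed.

(** Rapidity makes the height of coordinate [k] injective on [S], hence unbounded. A tuple whose
    [k]-th height exceeds that of [x] has all its heights above it. *)
Lemma rapid_unbounded n (S : (Fin.t n -> Node M) -> Prop) (k : Fin.t n) : rapid S -> size_kappa M S ->
  forall b, exists x, S x /\ forall k, lt b (fst (x k)).
Proof.
  intros HR [[f [Hf If]] _].
  assert (Hu : unbounded (fun d => exists x, S x /\ fst (x k) = d)).
  { apply unbounded_of_inj. exists (fun a => fst (f a k)). split; [eauto|].
    intros a a' _ _ E. apply If; auto. apply (@rapid_eq n S _ _ k HR); auto. }
  intros b. destruct (Hu b) as [d [[x [Hx Ex]] Hbd]]. destruct (Hu d) as [d' [[y [Hy Ey]] Hdd']].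
  exists y. split; [assumption|]. intros k'. destruct (HR x y Hx Hy) as [H | H].
  - intros E. specialize (E k). rewrite E in Ex. rewrite Ey in Ex. subst. ord.
  - specialize (H k k'). rewrite Ex in H. ord.
  - specialize (H k k). rewrite Ex, Ey in H. ord.
Qed.

Lemma meet_eq (x y : Node M) z : lt z (fst x) -> lt z (fst y) ->
  (forall u, lt u z -> snd x u = snd y u) -> snd x z <> snd y z -> meet x y = (z, restrict (snd x) z).
Proof.
  intros Hx Hy Hu Hne. assert (E : Delta x y = z).
  { apply least_eq; [tauto|]. intros u [[_ [_ H]] | [-> | ->]]; [|now left | now left].
    apply not_olt. auto. }
  unfold meet. now rewrite E.
Qed.

Lemma good_pair_intro n (c : Node M -> K M) (x y : Fin.t n -> Node M) tau z :
  (forall k k', lt (fst (x k)) (fst (y k'))) ->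
  (forall k, lt z (fst (x k)) /\ lt z (fst (y k)) /\ (forall u, lt u z -> snd (x k) u = snd (y k) u) /\
    snd (x k) z <> snd (y k) z /\ c (z, restrict (snd (x k)) z) = tau k) -> good_pair 1 c x y tau.
Proof.
  intros Hxy H. assert (E : forall k, meet (x k) (y k) = (z, restrict (snd (x k)) z)).
  { intros k. destruct (H k) as [H1 [H2 [H3 [H4 _]]]]. now apply meet_eq. }
  split; [|split].
  - intros k. rewrite E. apply H.
  - auto.
  - exists (z :: nil). split; [auto|]. intros k. rewrite E. now left.
Qed.

(** The tuple with smaller heights is put first, which settles the lexicographic condition; the
    condition on [z] is symmetric. *)
Lemma good_pair_of_rapid n (S : (Fin.t n -> Node M) -> Prop) (c : Node M -> K M) tau x y z :
  0 < n -> rapid S -> S x -> S y ->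
  (forall k, lt z (fst (x k)) /\ lt z (fst (y k)) /\ (forall u, lt u z -> snd (x k) u = snd (y k) u) /\
    snd (x k) z <> snd (y k) z /\ c (z, restrict (snd (x k)) z) = tau k) ->
  exists x y, S x /\ S y /\ ~ (forall k, x k = y k) /\ good_pair 1 c x y tau.
Proof.
  intros Hn HR Hx Hy H. assert (Hne : ~ forall k, x k = y k).
  { destruct n as [|n]; [lia|]. intros E. destruct (H Fin.F1) as [_ [_ [_ [Hd _]]]]. now rewrite E in Hd. }
  destruct (HR x y Hx Hy Hne) as [Hl | Hl].
  - exists x, y. repeat (split; [assumption|]). now apply good_pair_intro with (z := z).
  - exists y, x. split; [assumption|]. split; [assumption|]. split; [auto|].
    apply good_pair_intro with (z := z); [assumption|]. intros k. destruct (H k) as [H1 [H2 [H3 [H4 H5]]]].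
    repeat split; auto; [intros; symmetry; auto|].
    rewrite <- H5. do 2 f_equal. apply restrict_ext. intros; symmetry; auto.
Qed.

(** * Nodes with extensions in [T'] of unbounded height *)

Section BigNodes.
Variable T' : Node M -> Prop.
Hypothesis T'_nodes : forall t, T' t -> Tnodes C t.
Hypothesis T'_unbounded : forall b, exists t, T' t /\ lt b (fst t).

Definition big z s : Prop := forall b, exists t, T' t /\ lt b (fst t) /\ restrict (snd t) z = s.

Lemma big_refine (Q : Node M -> Prop) z :
  (forall b, exists t, T' t /\ lt b (fst t) /\ Q t) ->
  exists s, level C z s /\ forall b, exists t, T' t /\ lt b (fst t) /\ Q t /\ restrict (snd t) z = s.
Proof.
  intros HQ. destruct (@pigeonhole_tuples 1 (fun x => T' (x Fin.F1) /\ Q (x Fin.F1)) z) as [s [Hs H]].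
  - intros x [Hx _] k. apply (Fin.caseS' k); [auto | intros p; inversion p].
  - intros b. destruct (HQ b) as [t [H1 [H2 H3]]]. exists (fun _ => t). auto.
  - exists (s Fin.F1). split; [apply Hs|]. intros b. destruct (H b) as [x [[[H1 H2] H3] H4]].
    exists (x Fin.F1). repeat split; auto. apply H3.
Qed.

Lemma big_extend z u s : le z u -> big z s -> exists s', big u s' /\ level C u s' /\ restrict s' z = s.
Proof.
  intros Hzu Hs. destruct (big_refine u Hs) as [s' [Hl H]]. exists s'. split; [|split; [assumption|]].
  - intros b. destruct (H b) as [t Ht]. exists t. tauto.
  - destruct (H z) as [t [_ [_ [Hz Hu]]]]. rewrite <- Hz, <- Hu. now apply restrict_restrict.
Qed.

Lemma big_restrict z u s : le z u -> big u s -> big z (restrict s z).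
Proof.
  intros Hzu H b. destruct (H b) as [t [H1 [H2 <-]]]. exists t. repeat split; auto.
  symmetry. now apply restrict_restrict.
Qed.

(** Were the big extension of [s] unique at every level, these extensions would form a cofinal
    branch. *)
Lemma big_split z s : big z s -> exists u s1 s2, le z u /\ s1 <> s2 /\
  big u s1 /\ big u s2 /\ restrict s1 z = s /\ restrict s2 z = s.
Proof.
  intros Hs. apply NNPP. intros Hno.
  pose (e := fun u => epsilon (inhabits s) (fun s' => big u s' /\ level C u s' /\ restrict s' z = s)).
  assert (He : forall u, le z u -> big u (e u) /\ level C u (e u) /\ restrict (e u) z = s).
  { intros u Hu. unfold e. apply epsilon_spec. now apply big_extend. }
  (* Points below [z] are read off at level [next z], so that [e] is only evaluated at levels from
     [z] on. *)
  pose (above_z := fun x => if excluded_middle_informative (lt x z) then z else x).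
  apply (@no_cofinal_branch M C Hsq (fun x => e (next (above_z x)) x)).
  intros v. destruct (max2 z v) as [w [Hzw [Hvw _]]]. destruct (He w Hzw) as [Hb [[d [Hd Ed]] Hr]].
  exists d. split; [ord|]. intros x Hx Hxv.
  set (x' := above_z x).
  assert (Hx' : le x x' /\ le z x' /\ le x' w).
  { unfold x', above_z. destruct excluded_middle_informative; repeat split; ord || apply ole_refl. }
  destruct Hx' as [H1 [H2 H3]]. destruct (next_spec x') as [H4 H5]. set (u := next x') in *.
  assert (Hzu : le z u) by ord. destruct (He u Hzu) as [Hbu [_ Hru]].
  assert (Ew : rho0 C x d = e w x) by (rewrite Ed, restrict_lt; [reflexivity | ord]).
  rewrite Ew. destruct (olt_or_ole w u) as [Hwu | Huw].
  - apply NNPP. intros Hne. apply Hno. exists w, (e w), (restrict (e u) w). split; [assumption|].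
    split; [|split; [assumption | split; [apply big_restrict with (u := u); [ord | assumption] | split; [assumption|]]]].
    + intros E. apply Hne. rewrite E. apply restrict_lt. ord.
    + rewrite restrict_restrict; assumption.
  - apply NNPP. intros Hne. apply Hno. exists u, (restrict (e w) u), (e u). split; [assumption|].
    split; [|split; [apply big_restrict with (u := w); [ord | assumption] | split; [assumption | split; [|assumption]]]].
    + intros E. apply Hne. rewrite <- E. symmetry. apply restrict_lt. ord.
    + rewrite restrict_restrict; assumption.
Qed.

(** One node of the list is split at a higher level and the others are extended to it; their
    distinct restrictions to [z] keep them apart. *)
Lemma big_many m : exists z l, length l = S m /\ NoDup l /\ forall s, In s l -> big z s.
Proof.
  induction m as [|m [z [l [Hlen [Hnd Hbig]]]]].
  - destruct (@big_refine (fun _ => True) (muK M)) as [s [_ Hs]].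
    { intros b. destruct (T'_unbounded b) as [t Ht]. exists t. tauto. }
    exists (muK M), (s :: nil). split; [reflexivity|]. split; [repeat constructor; auto|].
    intros s' [<- | []] b. destruct (Hs b) as [t Ht]. exists t. tauto.
  - destruct l as [|s l]; [discriminate|]. inversion Hnd as [|s' l' Hs Hnd' E]; subst s' l'.
    destruct (big_split (Hbig s (or_introl eq_refl))) as [u [s1 [s2 [Hzu [Hne [H1 [H2 [E1 E2]]]]]]]].
    pose (ext := fun s : K M -> list (K M) => epsilon (inhabits s) (fun s' => big u s' /\ restrict s' z = s)).
    assert (Hext : forall s : K M -> list (K M), In s l -> big u (ext s) /\ restrict (ext s) z = s).
    { intros s' Hs'. unfold ext. apply epsilon_spec.
      destruct (big_extend Hzu (Hbig s' (or_intror Hs'))) as [s'' H]. exists s''. tauto. }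
    assert (Hnot : forall s' : K M -> list (K M), restrict s' z = s -> ~ In s' (map ext l)).
    { intros s' Es' Hin. apply in_map_iff in Hin. destruct Hin as [s'' [<- Hin]].
      apply Hs. rewrite <- Es'. now rewrite (proj2 (Hext s'' Hin)). }
    exists u, (s1 :: s2 :: map ext l). split; [simpl in *; rewrite length_map; lia|]. split.
    + constructor; [|constructor; [now apply Hnot|]].
      * intros [E | E]; [congruence | now apply (Hnot s1)].
      * apply NoDup_map_NoDup_ForallPairs; [|assumption]. intros a b Ha Hb E.
        rewrite <- (proj2 (Hext a Ha)), E. now apply Hext.
    + intros s' [<- | [<- | Hin]]; [assumption | assumption|].
      apply in_map_iff in Hin. destruct Hin as [s'' [<- Hin]]. now apply Hext.
Qed.

Lemma big_tuple n : exists z (s : Fin.t n -> K M -> list (K M)),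
  (forall k k', s k = s k' -> k = k') /\ forall k, big z (s k).
Proof.
  destruct (big_many n) as [z [l [Hlen [Hnd Hbig]]]].
  exists z, (fun k => nth (proj1_sig (Fin.to_nat k)) l (fun _ => nil)).
  assert (Hk : forall k : Fin.t n, proj1_sig (Fin.to_nat k) < length l).
  { intros k. destruct (Fin.to_nat k) as [i Hi]. simpl. lia. }
  split.
  - intros k k' E. apply Fin.to_nat_inj. eapply NoDup_nth; eauto.
  - intros k. apply Hbig, nth_In, Hk.
Qed.

End BigNodes.

(** Levels are small, so at most mu nodes have height at most [b]. *)
Lemma nodes_unbounded (T' : Node M -> Prop) : (forall t, T' t -> Tnodes C t) -> size_kappa M T' ->
  forall b, exists t, T' t /\ lt b (fst t).
Proof.
  intros HT [Hinj _] b. apply NNPP. intros Hno. apply (kappa_big M). apply (inj_into_trans Hinj).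
  apply small_sub with (B := fun t => exists z, le z b /\ (z = fst t /\ level C z (snd t))).
  - intros t Ht. exists (fst t). split; [|split; [reflexivity | now apply Tnodes_level, HT]].
    apply not_olt. intros Hb. apply Hno. eauto.
  - apply small_union; [apply small_le|]. intros z _.
    apply small_sub with (B := fun t => eq z (fst t) /\ level C z (snd t)); [auto|].
    apply small_prod; [apply small_single | now apply level_small].
Qed.

(** Recursion along kappa chooses each tuple with all heights above those of the earlier tuples. *)
Lemma rapid_family n (T' : Node M -> Prop) z (s : Fin.t n -> K M -> list (K M)) :
  0 < n -> (forall k, big T' z (s k)) -> exists S : (Fin.t n -> Node M) -> Prop,
    (forall x, S x -> forall k, T' (x k) /\ restrict (snd (x k)) z = s k) /\ rapid S /\ size_kappa M S.
Proof.
  intros Hn Hbig. destruct (fin_enumeration n) as [l [_ Hl]].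
  pose (bd := fun x : Fin.t n -> Node M => epsilon (inhabits z) (fun b => forall k, lt (fst (x k)) b)).
  assert (Hbd : forall x k, lt (fst (x k)) (bd x)).
  { intros x. unfold bd. apply epsilon_spec.
    destruct (@small_family_bounded M _ (fun k => In k l) (fun k => fst (x k))) as [b Hb].
    - apply small_image with (f := fun i => nth i l (Fin.of_nat_lt Hn)) (A := fun _ => True); [|apply small_nat].
      intros k Hk. destruct (In_nth l k (Fin.of_nat_lt Hn) Hk) as [i [_ Hi]]. eauto.
    - exists b. auto. }
  destruct (@transfinite_choice M _ bd (fun b x => forall k, T' (x k) /\ restrict (snd (x k)) z = s k /\ lt b (fst (x k))))
    as [f Hf].
  { intros b. exists (fun k => epsilon (inhabits (z, fun _ => nil))
      (fun t => T' t /\ restrict (snd t) z = s k /\ lt b (fst t))).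
    intros k. apply epsilon_spec. destruct (Hbig k b) as [t Ht]. exists t. tauto. }
  assert (Hlt : forall a a' k k', lt a a' -> lt (fst (f a k)) (fst (f a' k'))).
  { intros a a' k k' Ha. destruct (Hf a') as [b [Hb H]]. specialize (Hb a Ha). specialize (Hbd (f a) k).
    destruct (H k') as [_ [_ H']]. ord. }
  assert (HR : rapid (fun x => exists a, f a = x)).
  { intros x y [a <-] [a' <-] Hne. destruct (olt_total a a') as [H | [H | H]]; [left; auto| |right; auto].
    destruct Hne. now subst a'. }
  exists (fun x => exists a, f a = x). split; [|split; [assumption|split]].
  - intros x [a <-] k. destruct (Hf a) as [b [_ H]]. destruct (H k). tauto.
  - exists f. split; [eauto|]. intros a a' _ _ E.
    destruct (olt_total a a') as [H | [H | H]]; [|assumption|];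
    apply (Hlt _ _ (Fin.of_nat_lt Hn) (Fin.of_nat_lt Hn)) in H; rewrite E in H; exfalso; ord.
  - exists (fun x => fst (x (Fin.of_nat_lt Hn))). split; [auto|]. intros x y Hx Hy E.
    now apply (rapid_eq HR Hx Hy E).
Qed.

End Tuples.

(** * The colouring, and both clauses of the relation *)

Lemma exists_colouring {M : SuccCard} (C : K M -> K M -> Prop) : square_star C ->
  in_Theta1 nat (Aset C) C (fun _ => True) -> forall n, exists c : Node M -> K M,
  forall (S : (Fin.t n -> Node M) -> Prop) tau z0,
  (forall x, S x -> forall k, Tnodes C (x k)) ->
  (forall b, exists x, S x /\ forall k, lt b (fst (x k))) ->
  (forall x, S x -> forall k k', tau k <> tau k' -> restrict (snd (x k)) z0 <> restrict (snd (x k')) z0) ->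
  exists x y z, S x /\ S y /\ forall k, lt z (fst (x k)) /\ lt z (fst (y k)) /\
    (forall u, lt u z -> snd (x k) u = snd (y k) u) /\ snd (x k) z <> snd (y k) z /\
    c (z, restrict (snd (x k)) z) = tau k.
Proof.
  intros Hsq [g [h [_ HT]]] n.
  destruct (WordMachine.word_selection n) as [sel [q [rank [Hrank Hsel]]]].
  destruct (decoder_exists Hsq) as [decode Hdec].
  (* The base colour is decoded at the node itself, so one colouring serves every [tau] whose
     distinct values belong to coordinates separated below [z0]. *)
  exists (fun t => decode t (base_colour g h sel t)). intros S tau z0 HS HSu Hsep.
  destruct (fin_enumeration n) as [l [_ Hl]].
  assert (Hz : exists z, lt z0 z /\ forall k, lt (tau k) z).
  { destruct (@small_bounded M (fun a => In a (z0 :: map tau l))) as [b Hb].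
    - apply small_image with (f := fun i => nth i (z0 :: map tau l) z0) (A := fun _ => True); [|apply small_nat].
      intros a Ha. destruct (In_nth _ _ z0 Ha) as [i [_ Hi]]. eauto.
    - exists b. split; [apply Hb; now left|]. intros k. apply Hb. right. now apply in_map. }
  destruct Hz as [z [Hz0 Htau]]. destruct (next_spec z) as [Hzn _].
  destruct (pigeonhole_tuples Hsq (next z) HS HSu) as [s [Hs Hsu]].
  destruct (Hdec n s tau z) as [nu [Hnu Hnud]]; [now exists z0 | assumption | assumption| |].
  { intros k k' E. apply NNPP. intros Hne. destruct (Hsu z) as [x [[Hx Hxs] _]].
    apply (Hsep x Hx k k' Hne). destruct (Hxs k) as [_ Ek]. destruct (Hxs k') as [_ Ek'].
    assert (Hle : le z0 (next z)) by ord.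
    rewrite <- (restrict_restrict (snd (x k)) Hle), <- (restrict_restrict (snd (x k')) Hle). congruence. }
  (* All tuples considered share their restrictions to [next z], so the meets lie at or above
     [next z] and the decoding can see level [z]. *)
  destruct (common_meet Hsq HT
    (S := fun x => S x /\ forall k, lt (next z) (fst (x k)) /\ restrict (snd (x k)) (next z) = s k)
    (fun x Hx => HS x (proj1 Hx)) Hsu Hrank Hsel Hnu) as [x [y [u [[Hx Hxs] [[Hy Hys] H]]]]].
  exists x, y, u. split; [assumption|]. split; [assumption|]. intros k.
  destruct (H k) as [H1 [H2 [H3 [H4 H5]]]]. repeat (split; [assumption|]).
  rewrite H5. destruct (Hxs k) as [_ Ex]. destruct (Hys k) as [_ Ey].
  assert (Hu : le (next z) u).
  { apply not_olt. intros Hu. apply H4. apply (@restrict_eq M _ _ (next z)); [congruence | assumption]. }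
  apply Hnud; simpl; [ord|]. rewrite restrict_restrict; assumption.
Qed.

Theorem theorem9p3 (M : SuccCard) (C : K M -> K M -> Prop)
  (Hsq : square_star C)
  (HV : exists D, club D /\ forall d, D d -> Vset C d)
  (HTheta : in_Theta1 nat (Aset C) C (fun _ => True)) :
  forall n : nat, 0 < n -> neg_arrow (Tnodes C) n 1 (K M).
Proof.
  intros n Hn. destruct (exists_colouring Hsq HTheta n) as [c Hc]. exists c. split.
  - intros Sq HT HR Hsize tau.
    destruct (Hc Sq (fun _ => tau) (muK M) HT (rapid_unbounded (Fin.of_nat_lt Hn) HR Hsize)) as [x [y [z [Hx [Hy H]]]]].
    (* A constant [tau] makes the separation requirement vacuous. *)
    { intros; congruence. }
    now apply good_pair_of_rapid with x y z.
  - intros T' HT Hsize. pose proof (nodes_unbounded Hsq HT Hsize) as Hu.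
    (* Building tuples over distinct big nodes of one height separates the coordinates, so that
       arbitrary [tau] are allowed. *)
    destruct (big_tuple Hsq HT Hu n) as [z0 [s [Hs Hbig]]].
    destruct (rapid_family Hn Hbig) as [S' [HS' [HR Hsize']]].
    exists S'. split; [intros x Hx k; now apply HS'|]. split; [assumption|]. split; [assumption|].
    intros Sq Hsub HsizeSq tau.
    assert (HRSq : rapid Sq) by (intros x y Hx Hy; apply HR; auto).
    destruct (Hc Sq tau z0) as [x [y [z [Hx [Hy H]]]]].
    + intros x Hx k. now apply HT, HS', Hsub.
    + exact (rapid_unbounded (Fin.of_nat_lt Hn) HRSq HsizeSq).
    + intros x Hx k k' Hne E. apply Hne. f_equal. apply Hs.
      destruct (HS' x (Hsub x Hx) k) as [_ <-]. destruct (HS' x (Hsub x Hx) k') as [_ <-]. assumption.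
    + now apply good_pair_of_rapid with x y z.
Qed.
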